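(* Let $d\ge2$, $0\le k\le d$ and $r\ge1$, and let $T\subset\mathbb R^d$ be a $d$-simplex. For $f\in\Delta_\ell(T)$ with $\ell\ge k$ set $$\mathbb B_r\Lambda^k(f):=\bigoplus_{s=\ell-k}^{\ell}\ \bigoplus_{e\in\Delta_s(f)}\left[\mathbb P_{r-(s+1)}(e)\otimes b_e\star_f\operatorname{Alt}^{\ell-k}(\mathscr T^e)\right].$$ Then, as subspaces of $\mathbb P_r\Lambda^k(T)$, $$\mathbb P_r\Lambda^k(T)=\bigoplus_{\ell=k}^d\ \bigoplus_{f\in\Delta_\ell(T)}\mathbb B_r\Lambda^k(f)=\bigoplus_{f\in\Delta_k(T)}\mathbb P_r\Lambda^k(f)\ \oplus\ \bigoplus_{\ell=k+1}^d\ \bigoplus_{f\in\Delta_\ell(T)}\mathbb B_r\Lambda^k(f).$$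
   Context: $T$ has barycentric coordinates $\lambda_0,\dots,\lambda_d$. $\Delta_s(f)$ is the set of $s$-dimensional subsimplices of $f$; each subsimplex is identified with its set of vertex indices. $\mathscr T^f\subseteq\mathbb R^d$ is the tangent space of $f$ (span of differences of vertices), $\mathscr T^T=\mathbb R^d$. $\operatorname{Alt}^k(V)$ is the space of alternating $k$-linear forms on $V$. For subspaces $W\subseteq V\subseteq\mathbb R^d$, $\operatorname{Alt}^m(W)$ is embedded in $\operatorname{Alt}^m(V)$ by pullback along the orthogonal projection $V\to W$. For $f\in\Delta_\ell(T)$ with a fixed orientation, $\star_f:\operatorname{Alt}^m(\mathscr T^f)\to\operatorname{Alt}^{\ell-m}(\mathscr T^f)$ is the Hodge star on $\mathscr T^f$, so $\star_f\operatorname{Alt}^{\ell-k}(\mathscr T^e)\subseteq\operatorname{Alt}^k(\mathscr T^f)\hookrightarrow\operatorname{Alt}^k(\mathscr T^T)$ for $e\subseteq f$. $b_e:=\prod_{i\in e}\lambda_i$. For $m\ge0$, $\mathbb P_m(e)$ is the space of polynomials of degree $\le m$ on $e$ (equal to $\mathbb R$ if $e$ is a vertex), viewed inside $\mathbb P_m(f)$ and $\mathbb P_m(T)$ through the Bernstein extension, i.e. as the span of the monomials $\prod_{i\in e}\lambda_i^{\alpha_i}$ with $\sum_{i\in e}\alpha_i=m$; $\mathbb P_m(e)=\{0\}$ for $m<0$. $\mathbb P_r\Lambda^k(f):=\mathbb P_r(f)\otimes\operatorname{Alt}^k(\mathscr T^f)$ is embedded in $\mathbb P_r\Lambda^k(T)=\mathbb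 P_r(T)\otimes\operatorname{Alt}^k(\mathscr T^T)$ by the Bernstein extension of the coefficients and the embedding $\operatorname{Alt}^k(\mathscr T^f)\hookrightarrow\operatorname{Alt}^k(\mathscr T^T)$ given by pullback along the orthogonal projection $\mathscr T^T\to\mathscr T^f$; $\mathbb B_r\Lambda^k(f)\subseteq\mathbb P_r\Lambda^k(f)$ is embedded in the same way. *)

(* Defs.v *)
From mathcomp Require Import all_boot all_order all_algebra.
From mathcomp Require Import boolp classical_sets functions reals.
From mathcomp Require Import mpoly.

Import Order.TTheory GRing.Theory Num.Theory.
Local Open Scope classical_set_scope.
Local Open Scope ring_scope.

Section LinearAlgebra.
Context {R : realType} {E : lmodType R}.

Definition lin_span (S : set E) : set E :=
  [set x | exists n (c : 'I_n -> R) (y : 'I_n -> E),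
     (forall i, S (y i)) /\ x = \sum_i c i *: y i].

Context {I : finType}.
Variables (P : {set I}) (W : I -> set E).

Definition sum_space : set E :=
  [set x | exists2 w : I -> E,
     (forall i, i \in P -> W i (w i)) & x = \sum_(i in P) w i].

(* For linear subspaces W i, this says that their sum is direct. *)
Definition direct_family : Prop :=
  forall w : I -> E, (forall i, i \in P -> W i (w i)) ->
    \sum_(i in P) w i = 0 -> forall i, i \in P -> w i = 0.

Definition is_direct_sum (V : set E) : Prop := V = sum_space /\ direct_family.

End LinearAlgebra.

(* Tuples (u_1, ..., u_k) of vectors of R^d are the rows of u : 'M_(k, d), and
   a linear subspace of R^d is the row space of a matrix W : 'M_d. *)
Section AlternatingForms.
Context {R : realType} {d : nat}.

Definition kform (k : nat) : Type := 'M[R]_(k, d) -> R.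

(* Only the values of [a] on tuples of vectors of W matter here. *)
Definition alternating_on {k : nat} (W : 'M[R]_d) (a : kform k) : Prop :=
  (forall (u v w : 'M[R]_(k, d)) (i : 'I_k) (b c : R),
     (u <= W)%MS -> (v <= W)%MS -> (w <= W)%MS ->
     row i u = b *: row i v + c *: row i w ->
     row' i v = row' i u -> row' i w = row' i u ->
     a u = b * a v + c * a w)
  /\ (forall (u : 'M[R]_(k, d)) (i j : 'I_k),
        (u <= W)%MS -> i != j -> row i u = row j u -> a u = 0).

(* The rows of kermx W^T span the orthogonal complement of W. *)
Definition orth_proj (W : 'M[R]_d) : 'M[R]_d := proj_mx W (kermx W^T).

(* Alt^k(W), embedded in Alt^k(R^d) by pullback along the orthogonal projection
   onto W.  For W <= V the projection R^d -> W factors through R^d -> V, so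
   this is compatible with the embeddings Alt^k(W) -> Alt^k(V). *)
Definition Alt (k : nat) (W : 'M[R]_d) : set (kform k) :=
  [set a | exists2 b : kform k,
     alternating_on W b & a = fun u => b (u *m orth_proj W)].

Definition orthonormal_basis {n : nat} (W : 'M[R]_d) (b : 'M[R]_(n, d)) : Prop :=
  b *m b^T = 1%:M /\ (b :=: W)%MS.

(* P (x) A, inside the space of k-forms with polynomial coefficients. *)
Definition tensor {k : nat} (P : set {mpoly R[d]}) (A : set (kform k)) :
    set ('M[R]_(k, d) -> {mpoly R[d]}) :=
  lin_span [set w | exists p a, [/\ P p, A a & w = fun u => a u *: p]].

(* Real polynomials of degree at most r. *)
Definition poly_deg_le (r : nat) : set {mpoly R[d]} := [set p | (msize p <= r.+1)%N].

Definition PLambda (r k : nat) : set ('M[R]_(k, d) -> {mpoly R[d]}) :=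
  tensor (poly_deg_le r) (Alt k 1%:M).

End AlternatingForms.

(* The simplex T has vertices v 0, ..., v d; its subsimplices are the nonempty
   sets of vertex indices. *)
Section Simplex.
Context {R : realType} {d : nat}.
Variables (v : 'I_d.+1 -> 'rV[R]_d).

Definition affinely_independent : Prop :=
  row_free (\matrix_(i < d) (v (lift ord0 i) - v ord0)).

Definition barycentric (lam : 'I_d.+1 -> {mpoly R[d]}) : Prop :=
  forall i, (msize (lam i) <= 2)%N /\
    forall j, (lam i).@[v j ord0] = (i == j)%:R.

Implicit Types e f : {set 'I_d.+1}.

Definition Delta (s : nat) f : {set {set 'I_d.+1}} :=
  [set e : {set 'I_d.+1} | (e \subset f) && (#|e| == s.+1)].

Definition sdim f : nat := #|f|.-1.

Definition tangent f : 'M[R]_d :=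
  (\sum_(i in f) \sum_(j in f) <<v i - v j>>)%MS.

(* For n = dim f: the edges of f issued from its vertex of least index, a basis
   of the tangent space of f. *)
Definition edges (n : nat) f : 'M[R]_(n, d) :=
  \matrix_(i < n) (v (nth ord0 (enum f) i.+1) - v (nth ord0 (enum f) 0)).

(* An orientation of f is given by a boolean o: [false] is the orientation
   defined by the increasing order of the vertices, [true] is the opposite one.
   The sign of a basis b of the tangent space of f is 1 if b is positively
   oriented and -1 otherwise; that of the empty basis, when f is a vertex, is
   (-1) ^+ o. *)
Definition basis_sign (o : bool) {n : nat} f (b : 'M[R]_(n, d)) : R :=
  (-1) ^+ o * Num.sg (\det (b *m pinvmx (edges n f))).

(* c is the Hodge star of a on the tangent space of f, of dimension p + q:
     ( *a)(b_{p+1}, ..., b_{p+q}) = +/- a(b_1, ..., b_p)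
   for every orthonormal basis b, with + iff b is positively oriented.  This
   covers reordered bases, and agrees with alpha /\ *beta = <alpha, beta> vol. *)
Definition hodge_star (o : bool) {p q : nat} f
    (a : kform p) (c : kform q) : Prop :=
  Alt q (tangent f) c /\
  forall (x : 'M[R]_(p, d)) (y : 'M[R]_(q, d)),
    orthonormal_basis (tangent f) (col_mx x y) ->
    c y = basis_sign o f (col_mx x y) * a x.

(* The image under the Hodge star of f of Alt^(l-k)(T^e), for e included in f
   and l = dim f >= k. *)
Definition star_Alt (o : bool) (k : nat) f e : set (kform k) :=
  [set c | exists2 a : kform (sdim f - k),
     Alt (sdim f - k) (tangent e) a & hodge_star o f a c].

Variable lam : 'I_d.+1 -> {mpoly R[d]}.

(* P_m(e) through the Bernstein extension; it is {0} for m < 0. *)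
Definition Bernstein (m : int) e : set {mpoly R[d]} :=
  lin_span [set p | exists2 alpha : 'I_d.+1 -> nat,
    (\sum_(i in e) alpha i)%N%:Z = m & p = \prod_(i in e) lam i ^+ alpha i].

Definition bubble e : {mpoly R[d]} := \prod_(i in e) lam i.

Definition PLambda_face (r k : nat) f : set ('M[R]_(k, d) -> {mpoly R[d]}) :=
  tensor (Bernstein r%:Z f) (Alt k (tangent f)).

Variable o : {set 'I_d.+1} -> bool.

Definition BLambda_faces (k : nat) f : {set {set 'I_d.+1}} :=
  (\bigcup_(sdim f - k <= s < (sdim f).+1) Delta s f)%SET.

Definition BLambda_summand (r k : nat) f e :
    set ('M[R]_(k, d) -> {mpoly R[d]}) :=
  tensor [set bubble e * p | p in Bernstein (r%:Z - (sdim e).+1%:Z) e]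
         (star_Alt (o f) k f e).

Definition BLambda (r k : nat) f : set ('M[R]_(k, d) -> {mpoly R[d]}) :=
  sum_space (BLambda_faces k f) (BLambda_summand r k f).

(* The subsimplices of T of dimension at least k. *)
Definition faces_from (k : nat) : {set {set 'I_d.+1}} :=
  (\bigcup_(k <= l < d.+1) Delta l [set: 'I_d.+1])%SET.

End Simplex.

(* Main.v *)
(* Write lambda for the barycentric coordinates.  The polynomials of degree at
   most r have as a basis the monomials lambda^alpha with |alpha| = r; grouping
   them by support gives the direct sum of the spaces b_e P_{r - |e|}(e) over all
   faces e.  It thus suffices, for each e, to decompose the alternating k-forms as
   the direct sum of the spaces star_f Alt^{dim f - k}(T^e), over the faces f
   containing e.

   Let t_1, ..., t_s be an orthonormal basis of T^e and, for each vertex i outside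
   e, let n_i be the component orthogonal to T^e of an edge from e to i.  They
   form a basis of R^d, the dual vectors of the n_i being the gradients of the
   lambda_i.  Since the n_i with i in f \ e span the orthogonal complement of T^e
   in T^f, the Hodge star of a form of T^e is the product of all these n_i with a
   form of T^e.  So star_f Alt^{dim f - k}(T^e) is spanned by the products of k
   vectors of this basis that involve exactly the n_i with i in f \ e, and each
   product of k basis vectors occurs for exactly one f.

   When dim f = k, every k-form on T^f is a multiple of the volume form, which is
   in star_f Alt^0(T^e) for each e, so BLambda f is PLambda_face f. *)

Require Import Defs.
From mathcomp Require Import all_boot all_order all_algebra.
From mathcomp Require Import boolp classical_sets functions reals.
From mathcomp Require Import mpoly.
From mathcomp Require Import fintype finset fingroup perm.
From mathcomp Require Import ring zify.
Import Order.TTheory GRing.Theory Num.Theory.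
Local Open Scope ring_scope.

(** * Alternating forms *)

Section Multilinear.
Context {R : realType} {k n : nat}.
Implicit Types (G : 'M[R]_(k, n) -> R) (A : 'M[R]_(k, n)).

Definition multilinear G : Prop :=
  forall (u v w : 'M[R]_(k, n)) (i : 'I_k) (b c : R),
    row i u = b *: row i v + c *: row i w ->
    row' i v = row' i u -> row' i w = row' i u ->
    G u = b * G v + c * G w.

Definition set_row (i : 'I_k) (x : 'rV[R]_n) A : 'M[R]_(k, n) :=
  \matrix_i' (if i' == i then x else row i' A).

Lemma row_set_row i x A i' :
  row i' (set_row i x A) = if i' == i then x else row i' A.
Proof. by rewrite rowK. Qed.

Lemma row'_set_row i x A : row' i (set_row i x A) = row' i A.
Proof. by apply/matrixP=> a b; rewrite !mxE eq_sym (negPf (neq_lift _ _)) mxE. Qed.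

Lemma set_row_id i A : set_row i (row i A) A = A.
Proof. by apply/row_matrixP=> i'; rewrite row_set_row; case: eqP => // ->. Qed.

Lemma multilinear_row0 G i A : multilinear G -> row i A = 0 -> G A = 0.
Proof.
move=> lG A0; rewrite (lG A A A i 0 0) ?mul0r ?addr0 //.
by rewrite !scale0r addr0.
Qed.

Lemma multilinear_set_row_sum G i A (J : Type) (s : seq J) (c : J -> R) x :
  multilinear G ->
  G (set_row i (\sum_(j <- s) c j *: x j) A)
    = \sum_(j <- s) c j * G (set_row i (x j) A).
Proof.
move=> lG; elim: s => [|j s IHs].
  by rewrite !big_nil (@multilinear_row0 _ i) // row_set_row eqxx.
rewrite !big_cons -IHs -[X in _ = _ + X]mul1r.
by apply: (lG _ _ _ i); rewrite ?row'_set_row ?row_set_row ?eqxx ?scale1r.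
Qed.

(** Expanding the rows of [A] one after the other in the standard basis reduces the claim to
    matrices whose rows are all unit vectors. *)
Lemma multilinear_eq0 G :
  multilinear G ->
  (forall phi : {ffun 'I_k -> 'I_n}, G (rowsub phi 1%:M) = 0) ->
  forall A, G A = 0.
Proof.
move=> lG G0.
(* The rows of index at least [m] are already unit vectors; [m] counts the rows still to be
   expanded. *)
suff gen m : (m <= k)%N -> forall A,
    (forall i : 'I_k, (m <= i)%N -> exists j, row i A = delta_mx 0 j) -> G A = 0.
  by move=> A; apply: (gen k) => // i; rewrite leqNgt ltn_ord.
elim: m => [|m IHm] lemk A rowA.
  have [phi phiP] := choice (fun i => rowA i (leq0n i)).
  suff -> : A = rowsub [ffun i => phi i] 1%:M by [].
  apply/row_matrixP => i; rewrite phiP; apply/rowP=> j.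
  by rewrite !mxE ffunE eqxx eq_sym.
pose i := Ordinal lemk.
rewrite -(set_row_id i A) {1}(row_sum_delta (row i A)).
rewrite multilinear_set_row_sum // big1 // => j _.
rewrite (IHm (ltnW lemk)) ?mulr0 // => i' lemi'; rewrite row_set_row.
case: eqP => [_|ne_i]; first by exists j.
apply: rowA; rewrite ltn_neqAle lemi' andbT; apply/eqP => em.
by apply: ne_i; apply/val_inj.
Qed.

Lemma multilinearB G H :
  multilinear G -> multilinear H -> multilinear (fun A => G A - H A).
Proof.
move=> lG lH u v w i b c e1 e2 e3.
by rewrite (lG _ _ _ _ _ _ e1 e2 e3) (lH _ _ _ _ _ _ e1 e2 e3); ring.
Qed.

Lemma multilinear_sum (J : finType) (c : J -> R) (G : J -> 'M[R]_(k, n) -> R) :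
  (forall j, multilinear (G j)) -> multilinear (fun A => \sum_j c j * G j A).
Proof.
move=> lG u v w i b c' e1 e2 e3; rewrite !mulr_sumr -big_split /=.
by apply: eq_bigr => j _; rewrite (lG _ _ _ _ _ _ _ e1 e2 e3); ring.
Qed.

Lemma multilinear_prod (phi : 'I_k -> 'I_n) :
  multilinear (fun A => \prod_i A i (phi i)).
Proof.
move=> u v w i b c e1 e2 e3; have prodD1 (x : 'M[R]_(k, n)) :
    \prod_j x j (phi j) = x i (phi i) * \prod_(j | j != i) x j (phi j).
  by rewrite (bigD1 i).
rewrite !prodD1; have -> : u i (phi i) = b * v i (phi i) + c * w i (phi i).
  by move/rowP: e1 => /(_ (phi i)); rewrite !mxE.
have eq_off (x : 'M[R]_(k, n)) : row' i x = row' i u ->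
    \prod_(j | j != i) x j (phi j) = \prod_(j | j != i) u j (phi j).
  move=> ex; apply: eq_bigr => j; rewrite eq_sym => /unlift_some[l -> _].
  by move/matrixP: ex => /(_ l (phi (lift i l))); rewrite !mxE.
by rewrite (eq_off v) // (eq_off w) //; ring.
Qed.

End Multilinear.

Section AlternatingExpansion.
Context {R : realType} {d k : nat}.
Implicit Types a : @kform R d k.

Lemma alternating_multilinear a : alternating_on 1%:M a -> multilinear a.
Proof. by case=> la _ u v w i b c; apply: la; rewrite submx1. Qed.

Lemma alternating_eq_row a u i j :
  alternating_on 1%:M a -> i != j -> row i u = row j u -> a u = 0.
Proof. by case=> _ za; apply: za; rewrite submx1. Qed.

Lemma alternating_row0 a u i :
  alternating_on 1%:M a -> row i u = 0 -> a u = 0.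
Proof. by move/alternating_multilinear/multilinear_row0; apply. Qed.

Lemma multilinear_mulmx n (M : 'M[R]_(n, d)) a :
  multilinear a -> multilinear (fun A => a (A *m M)).
Proof.
move=> la u v w i b c e1 e2 e3; apply: (la _ _ _ i).
- by rewrite !row_mul e1 mulmxDl -!scalemxAl.
- by rewrite !row'Esub -!mul_rowsub_mx -!row'Esub e2.
- by rewrite !row'Esub -!mul_rowsub_mx -!row'Esub e3.
Qed.

(** Polarization: with the sum of rows [i] and [j] put in both places the form vanishes, and so do
    the two terms of its expansion with a repeated row. *)
Lemma alternating_swap a u i j :
  alternating_on 1%:M a -> i != j -> a (xrow i j u) = - a u.
Proof.
move=> aa neq; have la := alternating_multilinear _ aa.
pose S x y := set_row i x (set_row j y u).
have S0 x : a (S x x) = 0.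
  apply: (alternating_eq_row _ _ i j aa neq).
  by rewrite !row_set_row eqxx eq_sym (negPf neq) eqxx.
have Sl x y z : a (S (x + y) z) = a (S x z) + a (S y z).
  rewrite -[a (S x z)]mul1r -[a (S y z)]mul1r; apply: (la _ _ _ i).
  - by rewrite !row_set_row eqxx !scale1r.
  - by rewrite !row'_set_row.
  - by rewrite !row'_set_row.
have Sr x y z : a (S z (x + y)) = a (S z x) + a (S z y).
  rewrite -[a (S z x)]mul1r -[a (S z y)]mul1r; apply: (la _ _ _ j).
  - by rewrite !row_set_row eq_sym (negPf neq) eqxx !scale1r.
  - apply/matrixP=> p q; rewrite !mxE; case: eqP => // _; rewrite !mxE.
    by rewrite eq_sym (negPf (neq_lift _ _)).
  - apply/matrixP=> p q; rewrite !mxE; case: eqP => // _; rewrite !mxE.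
    by rewrite eq_sym (negPf (neq_lift _ _)).
have Su : S (row i u) (row j u) = u.
  by rewrite /S set_row_id set_row_id.
have Sx : S (row j u) (row i u) = xrow i j u.
  apply/row_matrixP => l; rewrite !row_set_row xrowEsub row_rowsub.
  case: eqP => [->|/eqP li]; first by rewrite tpermL.
  case: eqP => [->|/eqP lj]; first by rewrite tpermR.
  by rewrite tpermD // eq_sym.
have := S0 (row i u + row j u); rewrite Sl !Sr !S0 Su Sx add0r addr0.
by move/eqP; rewrite addrC addr_eq0 => /eqP.
Qed.

Lemma alternating_perm a u (s : 'S_k) :
  alternating_on 1%:M a -> a (rowsub s u) = (-1) ^+ s * a u.
Proof.
move=> aa; have [ts -> dts] := prod_tpermP s.
elim: ts dts u => [|[i j] ts IHts] /= => [_ u|/andP[nij dts] u].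
  by rewrite big_nil odd_perm1 mul1r mxsub_eq_id // => x; rewrite perm1.
rewrite big_cons odd_mul_tperm nij signr_addb expr1 -mulrA.
have -> : rowsub (tperm i j * \prod_(t <- ts) tperm t.1 t.2)%g u
   = xrow i j (rowsub (\prod_(t <- ts) tperm t.1 t.2)%g u).
  by rewrite xrowEsub -rowsub_comp; apply: eq_rowsub => x; rewrite permM.
by rewrite alternating_swap // IHts // mulN1r.
Qed.

Lemma alternating_inj a n (M : 'M[R]_(n, d)) (phi : {ffun 'I_k -> 'I_n}) :
  alternating_on 1%:M a -> a (rowsub phi M) != 0 -> injective phi.
Proof.
move=> aa nz i j eij; apply/eqP; apply: contraR nz => nij; apply/eqP.
by apply: (alternating_eq_row _ _ i j aa nij); rewrite !row_rowsub eij.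
Qed.

(** Both sides are multilinear in [A], so unit rows suffice; for these the product of entries
    selects a single index map. *)
Lemma multilinear_expand n (M : 'M[R]_(n, d)) (A : 'M[R]_(k, n)) a :
  multilinear a ->
  a (A *m M) = \sum_(phi : {ffun 'I_k -> 'I_n})
                 a (rowsub phi M) * \prod_i A i (phi i).
Proof.
move=> la; apply/eqP; rewrite -subr_eq0; apply/eqP; move: A.
apply: multilinear_eq0 => [|phi].
  apply: multilinearB; first exact: multilinear_mulmx.
  by apply: multilinear_sum => phi; apply: multilinear_prod.
rewrite (bigD1 phi) //= [X in _ * X + _]big1 => [|i _]; last by rewrite !mxE eqxx.
rewrite mul_rowsub_mx mul1mx mulr1 big1 ?addr0 ?subrr // => psi npsi.
have [i ni] : exists i, phi i != psi i.
  apply/existsP; apply: contraR npsi; rewrite negb_exists => /forallP e.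
  by apply/eqP/ffunP => i; apply/eqP; rewrite eq_sym; have := e i; rewrite negbK.
by rewrite (bigD1 i) //= !mxE (negPf ni) mul0r mulr0.
Qed.

(* Antisymmetrizing the multilinear expansion: the sum runs over all k-tuples
   of indices instead of the increasing ones, whence the factor k!. *)
Lemma alternating_expand n (M : 'M[R]_(n, d)) (A : 'M[R]_(k, n)) a :
  alternating_on 1%:M a ->
  a (A *m M) = k`!%:R^-1 * \sum_(phi : {ffun 'I_k -> 'I_n})
                 a (rowsub phi M) * \det (colsub phi A).
Proof.
move=> aa; have la := alternating_multilinear _ aa.
suff -> : \sum_(phi : {ffun 'I_k -> 'I_n}) a (rowsub phi M) * \det (colsub phi A)
    = k`!%:R * a (A *m M).
  by rewrite mulKf // pnatr_eq0 -lt0n fact_gt0.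
under eq_bigr do rewrite mulr_sumr.
rewrite exchange_big /= (eq_bigr (fun=> a (A *m M))) => [|s _].
  by rewrite sumr_const card_Sn mulr_natl.
rewrite multilinear_expand //.
pose h (phi : {ffun 'I_k -> 'I_n}) := [ffun i => phi ((s^-1)%g i)].
rewrite (reindex h) /=; last first.
  exists (fun phi => [ffun i => phi (s i)]) => phi _; apply/ffunP => i;
  by rewrite !ffunE ?permK ?permKV.
apply: eq_bigr => phi _.
have -> : rowsub (h phi) M = rowsub (s^-1)%g (rowsub phi M).
  by rewrite -rowsub_comp; apply: eq_rowsub => i; rewrite ffunE.
rewrite alternating_perm // odd_permV.
have -> : \prod_i (colsub (h phi) A) i (s i) = \prod_i A i (phi i).
  by apply: eq_bigr => i _; rewrite !mxE ffunE permK.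
by rewrite mulrACA -signr_addb addbb expr0 mul1r.
Qed.

(** This form is the wedge product of the covectors given by the columns of [C]. *)
Lemma det_form_alternating (C : 'M[R]_(d, k)) :
  alternating_on 1%:M (fun u : 'M[R]_(k, d) => \det (u *m C)).
Proof.
split=> [u v w i b c _ _ _ e1 e2 e3|u i j _ nij e].
  apply: (determinant_multilinear (i0 := i)).
  - by rewrite !row_mul e1 mulmxDl -!scalemxAl.
  - by rewrite !row'Esub -!mul_rowsub_mx -!row'Esub e2.
  - by rewrite !row'Esub -!mul_rowsub_mx -!row'Esub e3.
apply: (determinant_alternate nij) => l.
by have := congr1 (fun x => (x *m C) 0 l) e; rewrite -!row_mul !mxE.
Qed.

End AlternatingExpansion.

(** * Orthonormal bases *)

Section Masks.
Context {R : realType} {n : nat}.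
Implicit Types J K : {set 'I_n}.

(** The coordinate projection onto [J]. Bases of different tangent spaces can thus all be indexed by
    the vertices: [b *m b^T = mask J] says that the rows of [b] in [J] are orthonormal and that the
    others are zero. *)
Definition mask J : 'M[R]_n := diag_mx (\row_i (i \in J)%:R).

Lemma mask_mulE J m (A : 'M_(n, m)) i j :
  (mask J *m A) i j = (i \in J)%:R * A i j.
Proof. by rewrite mul_diag_mx !mxE. Qed.

Lemma mul_maskE J m (A : 'M_(m, n)) i j :
  (A *m mask J) i j = A i j * (j \in J)%:R.
Proof. by rewrite mul_mx_diag !mxE. Qed.

Lemma maskE J i j : mask J i j = ((i == j) && (i \in J))%:R.
Proof. by rewrite !mxE; case: eqP => [->|]; case: (_ \in J). Qed.

Lemma row_mask J m (A : 'M_(n, m)) i :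
  row i (mask J *m A) = if i \in J then row i A else 0.
Proof.
by apply/rowP => j; rewrite mxE mask_mulE; case: (i \in J); rewrite !mxE ?mul1r ?mul0r.
Qed.

Lemma mask_mul J K : mask J *m mask K = mask (J :&: K).
Proof.
apply/matrixP => i j; rewrite mask_mulE !maskE inE.
by case: (i == j); case: (i \in J); rewrite ?mul0r ?mul1r.
Qed.

Lemma maskT : mask [set: 'I_n] = 1%:M.
Proof. by apply/matrixP=> i j; rewrite maskE !mxE inE andbT. Qed.

Lemma mask0 : mask set0 = 0.
Proof. by apply/matrixP=> i j; rewrite maskE !mxE inE andbF. Qed.

Lemma maskD J K : [disjoint J & K] -> mask J + mask K = mask (J :|: K).
Proof.
move/disjointFr => dJK; apply/matrixP=> i j; rewrite [LHS]mxE !maskE inE.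
move: (dJK i); case: (i == j); case: (i \in J) => /= h; rewrite ?addr0 ?add0r //.
by rewrite h ?addr0.
Qed.

Lemma maskC J m (A : 'M_(n, m)) : mask J *m A + mask (~: J) *m A = A.
Proof.
by rewrite -mulmxDl maskD ?setUCr ?maskT ?mul1mx // disjoints_subset setCK.
Qed.

Lemma tr_mask J : (mask J)^T = mask J.
Proof. exact: tr_diag_mx. Qed.

Lemma mask_sub J K m (A : 'M_(n, m)) :
  J \subset K -> mask J *m A = A -> mask K *m A = A.
Proof. by move=> sJK <-; rewrite mulmxA mask_mul (setIidPr sJK). Qed.

Lemma mask_disjoint J K m (A : 'M_(n, m)) :
  [disjoint J & K] -> mask J *m A = A -> mask K *m A = 0.
Proof.
move=> dJK <-; rewrite mulmxA mask_mul.
by move: dJK; rewrite -setI_eq0 setIC => /eqP ->; rewrite mask0 mul0mx.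
Qed.

End Masks.

(** * Gram-Schmidt orthonormalization and pullback along orthogonal projections *)

Section Orthonormalization.
Context {R : realType} {n d : nat}.

Lemma mulmx_tr_eq0 (x : 'rV[R]_d) : x *m x^T = 0 -> x = 0.
Proof.
move/matrixP/(_ 0 0); rewrite !mxE => /eqP; rewrite psumr_eq0 => [/allP xx|i _].
  apply/rowP=> j; have := xx j (mem_index_enum _); rewrite mxE mulf_eq0 orbb => /eqP ->.
  by rewrite mxE.
by rewrite mxE -expr2 sqr_ge0.
Qed.

Lemma mulmx_tr_gt0 (x : 'rV[R]_d) : x != 0 -> 0 < (x *m x^T) 0 0.
Proof.
move=> nx; rewrite lt_def; apply/andP; split.
  apply: contra nx => /eqP xx; apply/eqP/mulmx_tr_eq0.
  by rewrite [LHS]mx11_scalar xx; apply/matrixP=> i j; rewrite !mxE mul0rn.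
by rewrite mxE sumr_ge0 // => i _; rewrite mxE -expr2 sqr_ge0.
Qed.

Lemma row_mul_tr p q (A : 'M[R]_(p, d)) (B : 'M[R]_(q, d)) i j :
  row i A *m (row j B)^T = ((A *m B^T) i j)%:M.
Proof.
rewrite [LHS]mx11_scalar; congr (_%:M).
by rewrite !mxE; apply: eq_bigr => l _; rewrite !mxE.
Qed.

(** The diagonal of the Gram matrix says that the rows outside [J] have norm zero. *)
Lemma gram_mask_row (J : {set 'I_n}) (b : 'M[R]_(n, d)) :
  b *m b^T = mask J -> mask J *m b = b.
Proof.
move=> bb; apply/row_matrixP=> i; rewrite row_mask; case: ifPn => // iJ.
apply/esym/mulmx_tr_eq0; rewrite row_mul_tr bb maskE (negPf iJ) andbF.
exact: raddf0.
Qed.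

(** Induction on the cardinality of [J]. Independence of the rows of [N] in [J] is expressed by a
    dual family, the rows of [G] in [J], which also shows that each new vector is nonzero. *)
Lemma gram_schmidt (J : {set 'I_n}) (N G : 'M[R]_(n, d)) :
  mask J *m N = N -> N *m G^T *m mask J = mask J ->
  exists b : 'M[R]_(n, d), b *m b^T = mask J /\ (b :=: N)%MS.
Proof.
elim: {J}#|J| {-2}J (erefl #|J|) N => [|m IHm] J cJ N JN NG.
  exists 0; move: JN; rewrite (cards0_eq cJ) mask0 mul0mx => <-.
  by rewrite mul0mx.
have [x Jx] : exists x, x \in J by apply/set0Pn; rewrite -card_gt0 cJ.
pose J' := J :\ x; pose N' := mask J' *m N.
have sJ' : J' \subset J by rewrite subsetDl.
have NGE i j : j \in J -> (N *m G^T) i j = (i == j)%:R.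
  move=> jJ; move/matrixP: NG => /(_ i j); rewrite mul_maskE maskE jJ mulr1 => ->.
  by case: eqP => [->|//]; rewrite jJ.
have cJ' : #|J'| = m by move: cJ; rewrite (cardsD1 x) Jx => -[].
have [||b' [bb' bN']] := IHm J' cJ' N'.
- by rewrite /N' mulmxA mask_mul setIid.
- apply/matrixP=> i j; rewrite mul_maskE /N' -mulmxA mask_mulE maskE.
  case jJ': (j \in J'); last by rewrite mulr0; case: eqP => // ->; rewrite jJ'.
  rewrite NGE; last exact: (subsetP sJ' _ jJ').
  by rewrite -!natrM; case: (i == j); case: (i \in J').
(* [w] is the part of row [x] orthogonal to the other rows. It is nonzero because its product with
   row [x] of [G] is 1, that row of [G] being orthogonal to [b']. *)
pose u := row x N; pose w := u - u *m b'^T *m b'.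
have b'x : b' *m (row x G)^T = 0.
  have /submxP[X ->] : (b' <= N')%MS by rewrite bN'.
  rewrite -mulmxA; suff -> : N' *m (row x G)^T = 0 by rewrite mulmx0.
  apply/row_matrixP=> i; rewrite row_mul row_mask row0.
  case: ifP => [|_]; last by rewrite mul0mx.
  by rewrite !inE => /andP[/negPf ix _]; rewrite row_mul_tr NGE // ix raddf0.
have wG : w *m (row x G)^T = 1%:M.
  by rewrite mulmxBl -!mulmxA b'x !mulmx0 subr0 row_mul_tr NGE // eqxx.
have nw : w != 0.
  apply/eqP => w0; move: wG; rewrite w0 mul0mx => /matrixP/(_ 0 0).
  by rewrite !mxE => /eqP; rewrite eq_sym oner_eq0.
pose c := Num.sqrt ((w *m w^T) 0 0).
have cgt0 : 0 < c by rewrite sqrtr_gt0 mulmx_tr_gt0.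
pose y := c^-1 *: w.
have yy : y *m y^T = 1%:M.
  rewrite /y linearZ /= -scalemxAl -scalemxAr scalerA [w *m _]mx11_scalar.
  rewrite scale_scalar_mx -[(w *m w^T) 0 0]sqr_sqrtr ?ltW ?mulmx_tr_gt0 //.
  by rewrite -/c; congr (_%:M); field; rewrite gt_eqF.
have yb' : y *m b'^T = 0.
  rewrite /y -scalemxAl mulmxBl -[u *m _ *m _ *m _]mulmxA bb'.
  by rewrite -mulmxA -[in X in _ - X]tr_mask -trmx_mul gram_mask_row // subrr scaler0.
(* The new unit vector is stored in row [x], which is zero in [b']. *)
pose b := b' + delta_mx x 0 *m y.
have b'y : b' *m y^T = 0 by apply: trmx_inj; rewrite trmx_mul trmxK yb' trmx0.
have b_b : b *m b^T = mask J.
  rewrite /b linearD /= trmx_mul mulmxDl !mulmxDr bb' -!mulmxA yb' mulmx0.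
  rewrite (mulmxA b') b'y mul0mx addr0 add0r (mulmxA y) yy mul1mx trmx_delta.
  rewrite mul_delta_mx -(setD1K Jx) -maskD; last by rewrite disjoints1 !inE eqxx.
  rewrite addrC; congr (_ + _); apply/matrixP=> i j; rewrite maskE !mxE inE.
  by case: (eqVneq i x) => [->|]; rewrite ?andbF ?andbT // eq_sym.
exists b; split=> //; apply/eqmxP/andP; split.
  have sN' : (N' <= N)%MS by apply: submxMl.
  have sb' : (b' <= N)%MS by rewrite bN'.
  apply: addmx_sub => //; apply: (submx_trans (submxMl _ _)).
  apply: scalemx_sub; apply: addmx_sub; first exact: row_sub.
  by rewrite eqmx_opp; apply: (submx_trans (submxMl _ _)).
have b'0 : row x b' = 0.
  by rewrite -(gram_mask_row _ _ bb') row_mask !inE eqxx.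
have sy : (y <= b)%MS.
  apply: (eq_row_sub x); rewrite raddfD /= b'0 add0r row_mul.
  by rewrite rowE mul_delta_mx -[RHS]mul1mx; congr (_ *m _); apply/matrixP=> i j; rewrite !mxE !ord1.
have sb' : (b' <= b)%MS.
  apply/row_subP=> i; case: (eqVneq i x) => [->|ix]; first by rewrite b'0 sub0mx.
  apply: (eq_row_sub i); rewrite raddfD /= row_mul [row i (delta_mx _ _)]rowE.
  by rewrite mul_delta_mx_0 // mul0mx addr0.
apply/row_subP=> i; case: (eqVneq i x) => [->|ix].
  rewrite -/u -(subrK (u *m b'^T *m b') u) -/w; apply: addmx_sub.
    by rewrite -[w](scalerKV (lt0r_neq0 cgt0)) scalemx_sub.
  by apply: submx_trans sb'; apply: submxMl.
case: (boolP (i \in J')) => iJ'; last first.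
  by rewrite -JN row_mask; move: iJ'; rewrite !inE ix /= => /negPf ->; rewrite sub0mx.
apply: submx_trans sb'; rewrite bN'; apply: (eq_row_sub i).
by rewrite row_mask iJ'.
Qed.

(** The rows of [b^T *m b] lie in [W] and those of [1%:M - b^T *m b] in its orthogonal complement,
    which meets [W] only in 0; so the projection fixes the former and kills the latter. *)
Lemma orth_proj_gram (W : 'M[R]_d) (J : {set 'I_n}) (b : 'M[R]_(n, d)) :
  b *m b^T = mask J -> (b :=: W)%MS -> orth_proj W = b^T *m b.
Proof.
move=> bb bW; rewrite /orth_proj; set K := kermx _.
have bbb : b *m b^T *m b = b by rewrite bb gram_mask_row.
have WK : (W :&: K = 0)%MS.
  apply/eqP; rewrite -submx0; apply/rV_subP => x; rewrite sub_capmx submx0.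
  case/andP=> /submxP[y ->] /sub_kermxP yK; apply/eqP/mulmx_tr_eq0.
  by rewrite trmx_mul mulmxA yK mul0mx.
have P2 : ((1%:M - b^T *m b) *m proj_mx W K = 0).
  apply: proj_mx_0 => //; apply/sub_kermxP.
  have /submxP[X ->] : (W <= b)%MS by rewrite bW.
  have := congr1 trmx bbb; rewrite !trmx_mul trmxK mulmxA => bbbT.
  by rewrite mulmxA mulmxBl mul1mx bbbT subrr mul0mx.
have P1 : b^T *m b *m proj_mx W K = b^T *m b.
  by apply: proj_mx_id => //; rewrite -bW submxMl.
by rewrite -P1; apply/eqP; rewrite -subr_eq0 -{1}[proj_mx _ _]mul1mx -mulmxBl P2.
Qed.

(** The projection is idempotent, so the forms pulled back from [W] are the alternating forms on the
    whole space that are invariant under it. *)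
Lemma AltP k (W : 'M[R]_d) (J : {set 'I_n}) (b : 'M[R]_(n, d)) (a : kform k) :
  b *m b^T = mask J -> (b :=: W)%MS ->
  Alt k W a <-> alternating_on 1%:M a /\ (forall u, a (u *m (b^T *m b)) = a u).
Proof.
move=> bb bW; rewrite /Alt /= (orth_proj_gram _ _ _ bb bW).
have bbb : b *m b^T *m b = b by rewrite bb gram_mask_row.
set P := b^T *m b.
have PP : P *m P = P by rewrite /P mulmxA -(mulmxA b^T) -mulmxA bbb.
have sP m (u : 'M_(m, d)) : (u *m P <= W)%MS.
  by rewrite -bW /P mulmxA submxMl.
split=> [[c [lc zc] ->]|[[la za] aP]]; last first.
  exists a; last by apply: funext => u; rewrite aP.
  by split=> [u v w i x y *|u i j *]; [apply: la; eauto using submx1 | apply: za; eauto using submx1].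
split; last by move=> u; rewrite -mulmxA PP.
split=> [u v w i x y _ _ _ e1 e2 e3|u i j _ ij e].
  apply: (lc _ _ _ i) => //.
  - by rewrite !row_mul e1 mulmxDl -!scalemxAl.
  - by rewrite !row'Esub -!mul_rowsub_mx -!row'Esub e2.
  - by rewrite !row'Esub -!mul_rowsub_mx -!row'Esub e3.
by apply: (zc _ i j) => //; rewrite !row_mul e.
Qed.

End Orthonormalization.

(** * Bases of tangent spaces adapted to a face *)

Section Faces.
Context {R : realType} {d : nat}.
Variable v : 'I_d.+1 -> 'rV[R]_d.
Implicit Types e f : {set 'I_d.+1}.

Lemma sub_tangent f i j : i \in f -> j \in f -> (v i - v j <= tangent v f)%MS.
Proof.
move=> fi fj; apply: (sumsmx_sup i) => //; apply: (sumsmx_sup j) => //.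
by rewrite genmxE.
Qed.

Lemma tangent_sub f x m (B : 'M[R]_(m, d)) : x \in f ->
  (forall i, i \in f -> (v i - v x <= B)%MS) -> (tangent v f <= B)%MS.
Proof.
move=> fx sB; apply/sumsmx_subP=> i fi; apply/sumsmx_subP=> j fj; rewrite genmxE.
by rewrite -(subrK (v x) (v i)) -addrA addmx_sub ?sB // -(opprB (v j)) eqmx_opp sB.
Qed.

Lemma tangentS e f : e \subset f -> (tangent v e <= tangent v f)%MS.
Proof.
move=> /subsetP sef; have [->|/set0Pn[x ex]] := eqVneq e finset.set0.
  by rewrite /tangent big_set0 sub0mx.
by apply: (tangent_sub _ _ _ _ ex) => i ei; apply: sub_tangent; apply: sef.
Qed.

Hypothesis v_affine : affinely_independent v.

Lemma tangentT : (tangent v [set: 'I_d.+1] :=: 1%:M)%MS.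
Proof.
apply/eqmxP; rewrite submx1 /=; set U := \matrix_(i < d) (v (lift ord0 i) - v ord0).
have fU : row_full U by rewrite row_full_unit -row_free_unit.
apply: (submx_trans (submx_full _ fU)).
by apply/row_subP=> i; rewrite rowK sub_tangent ?inE.
Qed.

(* The rows of G are the gradients of the barycentric coordinates. *)
Definition gradients (G : 'M[R]_(d.+1, d)) : Prop :=
  forall i j l, (v j - v l) *m (row i G)^T = ((i == j)%:R - (i == l)%:R)%:M.

Lemma gradients_exist : exists G, gradients G.
Proof.
pose U := \matrix_(i < d) (v (lift ord0 i) - v ord0).
have uU : U \in unitmx by rewrite -row_free_unit.
(* Entry [(i, j)] is the increment of the barycentric coordinate of index [j] along the edge in row
   [i] of [U]; inverting [U] recovers the gradients. *)
pose H : 'M[R]_(d, d.+1) := \matrix_(i, j) ((j == lift ord0 i)%:R - (j == ord0)%:R).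
exists (invmx U *m H)^T => i j l.
have base m : (v m - v ord0) *m (row i (invmx U *m H)^T)^T
    = ((i == m)%:R - (i == ord0)%:R)%:M.
  rewrite tr_row trmxK; case: (unliftP ord0 m) => [m' ->|->]; last first.
    by rewrite !subrr mul0mx raddf0.
  have -> : v (lift ord0 m') - v ord0 = row m' U by rewrite rowK.
  rewrite colE !mulmxA -row_mul mulmxV // -row_mul mul1mx -colE.
  by rewrite [LHS]mx11_scalar !mxE.
rewrite -(subrK (v ord0) (v j)) -addrA -(opprB (v l)) mulmxDl mulNmx !base.
by rewrite -raddfB /=; congr (_%:M); ring.
Qed.

(** The barycentric coordinate of a vertex outside [f] vanishes at all vertices of [f], hence is
    constant along [f]. *)
Lemma gradient_tangent G f i m (u : 'M[R]_(m, d)) :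
  gradients G -> i \notin f -> (u <= tangent v f)%MS -> u *m (row i G)^T = 0.
Proof.
move=> gG if' /submx_trans sub; apply/sub_kermxP; apply: sub.
have [->|/set0Pn[x fx]] := eqVneq f finset.set0.
  by rewrite /tangent big_set0 sub0mx.
apply: (tangent_sub _ _ _ _ fx) => j fj; apply/sub_kermxP; rewrite gG.
have /negPf-> : i != j by apply: contraNneq if' => ->.
have /negPf-> : i != x by apply: contraNneq if' => ->.
by rewrite subrr raddf0.
Qed.

Lemma gradients_tangent_mask G f m (u : 'M[R]_(m, d)) :
  gradients G -> (u <= tangent v f)%MS -> u *m G^T *m mask (~: f) = 0.
Proof.
move=> gG uf; apply/matrixP=> i j; rewrite mul_maskE inE mxE.
have [jf|jf] := boolP (j \in f); first by rewrite mulr0n mulr0 mxE.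
have /matrixP/(_ i 0) := gradient_tangent _ _ _ _ u gG jf uf; rewrite !mxE => uj.
rewrite mulr1n mulr1 -[RHS]uj.
by apply: eq_bigr => l _; rewrite !mxE.
Qed.

Lemma edges_tangent n f :
  f != finset.set0 -> n = sdim f -> (edges v n f :=: tangent v f)%MS.
Proof.
move=> f0 dn.
have cf : size (enum f) = n.+1 by rewrite -cardE dn prednK // card_gt0.
have gf i : (i < n.+1)%N -> nth ord0 (enum f) i \in f.
  by move=> li; rewrite -mem_enum mem_nth ?cf.
apply/eqmxP/andP; split.
  by apply/row_subP=> i; rewrite rowK; apply: sub_tangent; apply: gf => //; rewrite ltnS.
apply: (tangent_sub _ _ _ _ (gf 0%N isT)) => i fi.
have li : (index i (enum f) < n.+1)%N by rewrite -cf index_mem mem_enum.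
have <- : nth ord0 (enum f) (index i (enum f)) = i by rewrite nth_index ?mem_enum.
case: (index _ _) li => [|j] lj; first by rewrite subrr sub0mx.
by apply: (eq_row_sub (Ordinal (lj : (j < n)%N))); rewrite rowK.
Qed.

(* t is an orthonormal basis of the tangent space of e, and N extends it, by
   vectors orthogonal to e, to a basis of the tangent space of every f
   containing e.  Rows are indexed by the vertices; those of t vanish outside
   e minus e0, those of N vanish on e. *)
Record frame e (e0 : 'I_d.+1) (t N G : 'M[R]_(d.+1, d)) : Prop := Frame {
  frame_base : e0 \in e;
  frame_gram : t *m t^T = mask (e :\ e0);
  frame_tangent : (t :=: tangent v e)%MS;
  frame_mask : mask (~: e) *m N = N;
  frame_orth : N *m t^T = 0;
  frame_dual : N *m G^T *m mask (~: e) = mask (~: e);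
  frame_grad : gradients G;
  frame_span : forall f, e \subset f -> (tangent v f :=: (t + mask f *m N)%R)%MS }.

(** Gram-Schmidt on the edges of [e] issued from [e0] gives [t]; [N] consists of the components
    orthogonal to [e] of all edges issued from [e0], which are zero for the edges of [e]. *)
Lemma frame_exists e (e0 : 'I_d.+1) : e0 \in e -> exists t N G, frame e e0 t N G.
Proof.
move=> ee0; have [G gG] := gradients_exist.
pose V : 'M[R]_(d.+1, d) := \matrix_i (v i - v e0).
have VGE i j : j != e0 -> (V *m G^T) i j = (i == j)%:R.
  move=> je0; have /matrixP/(_ 0 0) := gG j i e0.
  rewrite (negPf je0) subr0 [RHS]mxE eqxx mulr1n eq_sym => <-.
  by rewrite !mxE; apply: eq_bigr => l _; rewrite !mxE.
have VG (J : {set 'I_d.+1}) : e0 \notin J ->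
    mask J *m V *m G^T *m mask J = mask J.
  move=> e0J; apply/matrixP=> i j; rewrite mul_maskE -mulmxA mask_mulE maskE.
  case jJ: (j \in J); last first.
    by rewrite mulr0; case: eqP => [->|//]; rewrite jJ.
  rewrite VGE; last by apply: contraTneq jJ => ->.
  by rewrite -!natrM; case: (i == j); case: (i \in J).
have [||t [tt tV]] := @gram_schmidt _ _ _ (e :\ e0) (mask (e :\ e0) *m V) G.
- by rewrite mulmxA mask_mul setIid.
- by apply: VG; rewrite !inE eqxx.
have te : (t :=: tangent v e)%MS.
  apply/eqmxP/andP; split; rewrite tV.
    apply/row_subP=> i; rewrite row_mask; case: ifP; rewrite ?sub0mx //.
    by rewrite rowK => /setD1P[_ ie]; rewrite sub_tangent.
  apply: (tangent_sub _ _ _ _ ee0) => i ei.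
  have [->|ie0] := eqVneq i e0; first by rewrite subrr sub0mx.
  by apply: (eq_row_sub i); rewrite row_mask !inE ie0 ei rowK.
have ttt : t *m t^T *m t = t by rewrite tt gram_mask_row.
have tK m (u : 'M[R]_(m, d)) : (u <= tangent v e)%MS -> u *m t^T *m t = u.
  by rewrite -te => /submxP[X ->]; rewrite -!mulmxA (mulmxA t) ttt.
pose N := V - V *m t^T *m t.
have Nt : N *m t^T = 0.
  have tm : t^T *m mask (e :\ e0) = t^T.
    by rewrite -[in LHS]tr_mask -trmx_mul gram_mask_row.
  by rewrite mulmxBl -(mulmxA _ t) tt -mulmxA tm subrr.
have mN : mask (~: e) *m N = N.
  rewrite -[RHS](maskC e); suff -> : mask e *m N = 0 by rewrite add0r.
  apply/row_matrixP=> i; rewrite row_mask row0; case: ifP => // ie.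
  by rewrite raddfB /= !row_mul rowK tK ?subrr // sub_tangent.
(* The gradients of the vertices outside [e] are orthogonal to [t], so removing from [V] its
   component along [e] preserves the duality with them. *)
have tG : t *m G^T *m mask (~: e) = 0.
  by apply: (gradients_tangent_mask _ _ _ _ gG); rewrite te.
have sub_e0 : e0 \notin ~: e by rewrite inE ee0.
exists t, N, G; split=> //.
  rewrite -[in LHS]mN -[RHS](VG _ sub_e0) mulmxBr !mulmxBl; apply/eqP.
  by rewrite subr_eq addrC -subr_eq subrr -!mulmxA (mulmxA t) tG !mulmx0.
move=> f sef; have fe0 := subsetP sef _ ee0.
have mt (J : {set 'I_d.+1}) : e \subset J -> mask J *m t = t.
  move=> sJ; apply: (mask_sub (e :\ e0)); last exact: gram_mask_row.
  exact: subset_trans (subsetDl _ _) sJ.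
have mt' : mask (~: e) *m t = 0.
  apply: (mask_disjoint e); last exact: mt.
  by rewrite disjoints_subset setCK.
apply/eqmxP/andP; split.
  have sN : (mask f *m N <= (t + mask f *m N)%R)%MS.
    suff E : mask (~: e) *m (t + mask f *m N) = mask f *m N.
      by rewrite -[X in (X <= _)%MS]E submxMl.
    by rewrite mulmxDr mt' add0r mulmxA mask_mul setIC -mask_mul -mulmxA mN.
  have st : (t <= (t + mask f *m N)%R)%MS.
    rewrite -[X in (X <= _)%MS](addrK (mask f *m N)).
    by apply: addmx_sub; rewrite ?eqmx_opp ?submx_refl.
  apply: (tangent_sub _ _ _ _ fe0) => i fi.
  have -> : v i - v e0 = row i V *m t^T *m t + row i (mask f *m N).
    by rewrite row_mask fi raddfB /= !row_mul [RHS]addrC subrK rowK.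
  rewrite addmx_sub //; last exact: submx_trans (row_sub _ _) sN.
  by apply: submx_trans st; rewrite submxMl.
have st : (t <= tangent v f)%MS by rewrite te tangentS.
rewrite addmx_sub // mulmxBr addmx_sub //.
  apply/row_subP=> i; rewrite row_mask; case: ifP; rewrite ?sub0mx // rowK => fi.
  by rewrite sub_tangent.
by rewrite eqmx_opp !mulmxA; apply: submx_trans st; rewrite submxMl.
Qed.

Section FrameTheory.
Context {e : {set 'I_d.+1}} {e0 : 'I_d.+1} {t N G : 'M[R]_(d.+1, d)}.
Hypothesis fr : frame e e0 t N G.

Lemma frame_mask_t (J : {set 'I_d.+1}) : e :\ e0 \subset J -> mask J *m t = t.
Proof. by move=> sJ; apply: mask_sub sJ _; apply/gram_mask_row/(frame_gram _ _ _ _ _ fr). Qed.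

Lemma frame_tG : t *m G^T *m mask (~: e) = 0.
Proof.
apply: gradients_tangent_mask; first exact: frame_grad fr.
by rewrite (frame_tangent _ _ _ _ _ fr).
Qed.

(** Two dual bases of the whole space, each with a zero row at [e0]. Their pairings give
    [M *m (D^T *m M) = M], from which [M] can be cancelled since its rows span the space. *)
Lemma frame_dual_basis : (t + mask (~: e) *m G)^T *m (t + N) = 1%:M.
Proof.
have ee0 := frame_base _ _ _ _ _ fr.
have fullM : row_full (t + N)%R.
  rewrite -sub1mx -[X in (t + X)%R]mul1mx -maskT.
  by rewrite -(frame_span _ _ _ _ _ fr _ (subsetT e)) tangentT.
set D := t + _; set M := (t + N)%R in fullM *.
suff MDM : M *m (D^T *m M) = M.
  by rewrite -[LHS]mul1mx -(mulVpmx fullM) -mulmxA MDM.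
rewrite mulmxA (_ : M *m D^T = mask (~: [set e0])).
  rewrite /M mulmxDr frame_mask_t; last by apply/subsetP=> i; rewrite !inE => /andP[].
  congr (_ + _); apply: mask_sub (frame_mask _ _ _ _ _ fr).
  by rewrite setCS sub1set.
rewrite /D linearD /= trmx_mul tr_mask mulmxDr !mulmxDl (frame_gram _ _ _ _ _ fr).
rewrite (frame_orth _ _ _ _ _ fr) !mulmxA frame_tG (frame_dual _ _ _ _ _ fr).
rewrite addr0 add0r maskD; last first.
  by rewrite disjoints_subset setCK subsetDl.
congr mask; apply/setP=> i; rewrite !inE.
by case: eqP => [->|]; rewrite ?ee0 //= orbN.
Qed.

(** Gram-Schmidt on the rows of [N] in [f] outside [e] gives [nu], still orthogonal to [e]; the rows
    of [t] and [nu] have disjoint supports, and [b] is their sum. *)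
Lemma face_basis f : e \subset f -> exists b : 'M[R]_(d.+1, d),
  [/\ b *m b^T = mask (f :\ e0), (b :=: tangent v f)%MS, mask e *m b = t
    & (mask (~: e) *m b :=: mask f *m N)%MS].
Proof.
move=> sef; have ee0 := frame_base _ _ _ _ _ fr.
have mN := frame_mask _ _ _ _ _ fr.
have mfN : mask (~: e) *m (mask f *m N) = mask f *m N.
  by rewrite mulmxA mask_mul setIC -mask_mul -mulmxA mN.
have [||nu [nn nN]] := @gram_schmidt _ _ _ (f :\: e) (mask f *m N) G.
- suff -> : mask f *m N = mask (f :\: e) *m N by rewrite mulmxA mask_mul setIid.
  by rewrite setDE -mask_mul -mulmxA mN.
- rewrite setDE setIC -mask_mul.
  suff : mask f *m (N *m G^T *m mask (~: e)) *m mask f = mask (~: e) *m mask f.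
    by rewrite !mulmxA.
  by rewrite (frame_dual _ _ _ _ _ fr) !mask_mul setIAC setIid setIC.
have mnu : mask (f :\: e) *m nu = nu by apply: gram_mask_row.
have nut : nu *m t^T = 0.
  have /submxP[X ->] : (nu <= mask f *m N)%MS by rewrite nN.
  by rewrite -!mulmxA (frame_orth _ _ _ _ _ fr) !mulmx0.
have tnu : t *m nu^T = 0 by apply: trmx_inj; rewrite trmx_mul trmxK nut trmx0.
have ent : mask e *m (t + nu) = t.
  rewrite mulmxDr frame_mask_t ?subsetDl // (mask_disjoint (f :\: e)) ?addr0 //.
  by rewrite disjoints_subset setDE subsetIr.
have ennu : mask (~: e) *m (t + nu) = nu.
  rewrite mulmxDr (mask_disjoint e) ?frame_mask_t ?subsetDl //; last first.
    by rewrite disjoints_subset setCK.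
  by rewrite add0r; apply: mask_sub mnu; rewrite setDE subsetIr.
exists (t + nu); split=> //.
- rewrite linearD /= mulmxDr !mulmxDl (frame_gram _ _ _ _ _ fr) nn nut tnu.
  rewrite addr0 add0r maskD; last first.
    rewrite disjoints_subset; apply/subsetP=> i; rewrite !inE => /andP[_ ->].
    by [].
  congr mask; apply/setP=> i; rewrite !inE.
  case: (eqVneq i e0) => [->|_] /=; first by rewrite ee0.
  by case: (boolP (i \in e)) => // /(subsetP sef) ->.
- apply: eqmx_trans (eqmx_sym (frame_span _ _ _ _ _ fr _ sef)).
  have fnN : mask (~: e) *m (t + mask f *m N) = mask f *m N.
    rewrite mulmxDr mfN (mask_disjoint e) ?add0r ?frame_mask_t ?subsetDl //.
    by rewrite disjoints_subset setCK.
  have fnt : mask e *m (t + mask f *m N) = t.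
    rewrite mulmxDr frame_mask_t ?subsetDl // -mfN mulmxA mask_mul.
    by rewrite setICr mask0 mul0mx addr0.
  apply/eqmxP/andP; split; apply: addmx_sub.
  + by rewrite -[X in (X <= _)%MS]fnt submxMl.
  + by rewrite nN -[X in (X <= _)%MS]fnN submxMl.
  + by rewrite -[X in (X <= _)%MS]ent submxMl.
  + by rewrite -nN -[X in (X <= _)%MS]ennu submxMl.
- by rewrite ennu.
Qed.

End FrameTheory.
End Faces.

(** * Hodge stars *)

Section OrthonormalBases.
Context {R : realType} {d : nat}.

(* Jacobi's complementary minor formula, for the orthogonal matrix that
   changes one orthonormal basis into the other. *)
Lemma orthogonal_complementary_minor p q (x x0 : 'M[R]_(p, d)) (y y0 : 'M[R]_(q, d)) :
  let Q := col_mx x y *m (col_mx x0 y0)^T in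
  Q *m Q^T = 1%:M -> \det Q * \det (x *m x0^T) = \det (y *m y0^T).
Proof.
rewrite /= tr_col_mx mul_col_row tr_block_mx mulmx_block scalar_mx_block.
set A := x *m x0^T; set B := x *m y0^T; set C := y *m x0^T; set D := y *m y0^T.
move/eq_block_mx => [e1 _ e3 _].
(* The right factor is the first block column of [Q^T] completed by an identity block. By
   orthogonality the product is block triangular with diagonal blocks 1 and [D]. *)
have /(congr1 determinant) : block_mx A B C D *m block_mx A^T 0 B^T 1%:M
    = block_mx 1%:M B 0 D.
  by rewrite mulmx_block !mulmx0 !mulmx1 !add0r e1 e3.
by rewrite det_mulmx det_lblock det_ublock !det1 mulr1 mul1r det_tr.
Qed.

Lemma orthonormal_change n (W : 'M[R]_d) (B B0 : 'M[R]_(n, d)) :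
  orthonormal_basis W B -> orthonormal_basis W B0 ->
  B = B *m B0^T *m B0 /\ B *m B0^T *m (B *m B0^T)^T = 1%:M.
Proof.
move=> [BB BW] [B0B0 B0W].
have /submxP[X eB] : (B <= B0)%MS by rewrite BW B0W.
have eX : B *m B0^T = X by rewrite eB -mulmxA B0B0 mulmx1.
rewrite eX; split=> //; rewrite -BB eB trmx_mul -mulmxA (mulmxA B0) B0B0.
by rewrite mul1mx.
Qed.

Lemma rowsub_gram m n p q (phi : 'I_p -> 'I_m) (psi : 'I_q -> 'I_n)
    (A : 'M[R]_(m, d)) (B : 'M[R]_(n, d)) :
  rowsub phi A *m (rowsub psi B)^T = mxsub phi psi (A *m B^T).
Proof. by rewrite trmx_mxsub -mxsub_mul. Qed.

Lemma rowsub_sub m p q (phi : 'I_p -> 'I_m) (A : 'M[R]_(m, d)) (B : 'M[R]_(q, d)) :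
  (forall i, (row (phi i) A <= B)%MS) -> (rowsub phi A <= B)%MS.
Proof. by move=> sB; apply/row_subP=> i; rewrite row_rowsub. Qed.

Lemma row_rowsub_sub m p (phi : 'I_p -> 'I_m) (A : 'M[R]_(m, d)) j :
  j \in [set phi i | i : 'I_p] -> (row j A <= rowsub phi A)%MS.
Proof. by case/imsetP=> i _ ->; apply: (eq_row_sub i); rewrite row_rowsub. Qed.

(** The basis vectors left over by [phi] complete those of index [phi] to a basis, on which a Hodge
    star can be evaluated. *)
Lemma injection_complement m p q (S : {set 'I_m}) (phi : 'I_q -> 'I_m) :
  injective phi -> (forall i, phi i \in S) -> #|S| = (p + q)%N ->
  exists2 phi' : 'I_p -> 'I_m, injective phi' &
    [set phi' i | i : 'I_p] = S :\: [set phi i | i : 'I_q].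
Proof.
move=> inj_phi phiS cS; set T := S :\: _.
have sub : [set phi i | i : 'I_q] \subset S by apply/subsetP=> _ /imsetP[i _ ->].
have cT : p = #|T|.
  by rewrite cardsD (setIidPr sub) cS card_imset // card_ord addnK.
exists (fun i => enum_val (cast_ord cT i)).
  by move=> i j /enum_val_inj/cast_ord_inj.
apply/setP=> j; apply/imsetP/idP=> [[i _ ->]|jT]; first exact: enum_valP.
exists (cast_ord (esym cT) (enum_rank_in jT j)) => //.
by rewrite cast_ordKV enum_rankK_in.
Qed.

Lemma orthonormal_split m p q (S : {set 'I_m}) (b : 'M[R]_(m, d)) (W : 'M[R]_d)
    (phi' : 'I_p -> 'I_m) (phi : 'I_q -> 'I_m) :
  b *m b^T = mask S -> (b :=: W)%MS -> injective phi' -> injective phi ->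
  (forall i, phi i \in S) -> [set phi' i | i : 'I_p] = S :\: [set phi i | i : 'I_q] ->
  orthonormal_basis W (col_mx (rowsub phi' b) (rowsub phi b)).
Proof.
move=> bb bW inj' inj phiS im'.
have phi'S i : phi' i \in S :\: [set phi i | i : 'I_q] by rewrite -im' imset_f.
have ne i j : phi' i == phi j = false.
  apply: contraTF (phi'S i) => /eqP->; rewrite inE negb_and negbK.
  by rewrite imset_f.
split.
  rewrite tr_col_mx mul_col_row !rowsub_gram bb scalar_mx_block.
  congr block_mx; apply/matrixP=> i j; rewrite mxE maskE mxE.
  - by rewrite (inj_eq inj'); have /setDP[-> _] := phi'S i; rewrite andbT.
  - by rewrite ne.
  - by rewrite eq_sym ne.
  - by rewrite (inj_eq inj) phiS andbT.
apply/eqmxP/andP; split; rewrite -bW.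
  by rewrite col_mx_sub !rowsub_sub // => i; apply: row_sub.
apply/row_subP=> j; rewrite -[X in row j X](gram_mask_row _ _ bb) row_mask.
case: ifP => [jS|_]; last exact: sub0mx.
have [jphi|jphi] := boolP (j \in [set phi i | i : 'I_q]).
  by apply: submx_trans (row_rowsub_sub _ _ _ _ _ jphi) _; rewrite -addsmxE addsmxSr.
have jphi' : j \in [set phi' i | i : 'I_p] by rewrite im' inE jphi.
by apply: submx_trans (row_rowsub_sub _ _ _ _ _ jphi') _; rewrite -addsmxE addsmxSl.
Qed.

Lemma det_form_Alt m q (S : {set 'I_m}) (b : 'M[R]_(m, d)) (W : 'M[R]_d)
    (y : 'M[R]_(q, d)) :
  b *m b^T = mask S -> (b :=: W)%MS -> (y <= W)%MS ->
  Alt q W (fun u => \det (u *m y^T)).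
Proof.
move=> bb bW yW; apply/(AltP _ _ _ _ _ bb bW); split; first exact: det_form_alternating.
move=> u; rewrite -mulmxA; suff -> : b^T *m b *m y^T = y^T by [].
move: yW; rewrite -bW => /submxP[X ->].
rewrite -[in RHS](gram_mask_row _ _ bb) -bb !trmx_mul !trmxK.
by rewrite !mulmxA.
Qed.

Lemma Alt_expand m q (S : {set 'I_m}) (b : 'M[R]_(m, d)) (W : 'M[R]_d) c :
  b *m b^T = mask S -> (b :=: W)%MS -> Alt q W c ->
  forall u, c u = q`!%:R^-1 * \sum_(phi : {ffun 'I_q -> 'I_m})
    c (rowsub phi b) * \det (u *m (rowsub phi b)^T).
Proof.
move=> bb bW /(AltP _ _ _ _ _ bb bW)[cc cP] u.
rewrite -cP mulmxA alternating_expand //; congr (_ * _).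
by apply: eq_bigr => phi _; rewrite trmx_mxsub mulmx_colsub.
Qed.

(** A repeated index produces equal rows, and an index outside [S] a zero row. *)
Lemma Alt_coef m q (S : {set 'I_m}) (b : 'M[R]_(m, d)) (W : 'M[R]_d) c
    (phi : {ffun 'I_q -> 'I_m}) :
  b *m b^T = mask S -> (b :=: W)%MS -> Alt q W c -> c (rowsub phi b) != 0 ->
  injective phi /\ forall i, phi i \in S.
Proof.
move=> bb bW /(AltP _ _ _ _ _ bb bW)[cc _] nz.
split=> [|i]; first exact: alternating_inj cc nz.
apply: contraR nz => nSi; apply/eqP/(alternating_row0 _ _ i cc).
by rewrite row_rowsub -(gram_mask_row _ _ bb) row_mask (negPf nSi).
Qed.

End OrthonormalBases.

Section BasisSign.
Context {R : realType} {d : nat}.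
Variable v : 'I_d.+1 -> 'rV[R]_d.

(** The change of basis is orthogonal, so its determinant is 1 or -1 and equals its own sign. The
    sign of [B0] is not 0 because the edges span the tangent space. *)
Lemma basis_sign_change n (o : bool) (f : {set 'I_d.+1}) (B B0 : 'M[R]_(n, d)) :
  f != finset.set0 -> n = sdim f ->
  orthonormal_basis (tangent v f) B -> orthonormal_basis (tangent v f) B0 ->
  basis_sign v o f B = \det (B *m B0^T) * basis_sign v o f B0
  /\ basis_sign v o f B0 ^+ 2 = 1.
Proof.
move=> f0 dn onB onB0; have [eB] := orthonormal_change _ _ _ _ onB onB0.
set Q := B *m _ in eB * => QQ.
have Q2 : \det Q ^+ 2 = 1.
  by have := congr1 determinant QQ; rewrite det_mulmx det_tr det1 expr2.
have sgQ : Num.sg (\det Q) = \det Q.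
  by move/eqP: Q2; rewrite sqrf_eq1 => /orP[]/eqP->; rewrite ?sgrN ?sgr1.
set E := edges v n f.
have nz : \det (B0 *m pinvmx E) != 0.
  have B0E : B0 *m pinvmx E *m E = B0.
    by rewrite mulmxKpV // (edges_tangent _ _ _ f0 dn) onB0.2.
  have := congr1 (fun X => \det (X *m B0^T)) B0E.
  rewrite /= onB0.1 det1 -mulmxA det_mulmx => h; apply/eqP => z.
  by move/eqP: h; rewrite z mul0r eq_sym oner_eq0.
rewrite /basis_sign; split; last by rewrite exprMn sqrr_sign mul1r sqr_sg nz.
by rewrite {1}eB -mulmxA det_mulmx sgrM sgQ mulrCA.
Qed.

End BasisSign.

(** * Hodge stars on a face of the forms of a subface *)

Section StarAlt.
Context {R : realType} {d : nat}.
Variable v : 'I_d.+1 -> 'rV[R]_d.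
Context {e : {set 'I_d.+1}} {e0 : 'I_d.+1} {t N G : 'M[R]_(d.+1, d)}.
Hypothesis fr : frame v e e0 t N G.
Variables (o : bool) (k : nat).

Section OneFace.
Variables (f : {set 'I_d.+1}) (b : 'M[R]_(d.+1, d)).
Hypotheses (sef : e \subset f) (lekf : (k <= sdim f)%N).
Hypothesis b_gram : b *m b^T = mask (f :\ e0).
Hypothesis b_tangent : (b :=: tangent v f)%MS.
Hypothesis b_e : mask e *m b = t.
Hypothesis b_Ce : (mask (~: e) *m b :=: mask f *m N)%MS.

Let ee0 : e0 \in e := frame_base _ _ _ _ _ _ fr.
Let fe0 : e0 \in f := subsetP sef _ ee0.
Let f_neq0 : f != finset.set0.
Proof. by apply/set0Pn; exists e0. Qed.

Let cardD1_face : #|f :\ e0| = (sdim f - k + k)%N.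
Proof. by rewrite subnK // /sdim (cardsD1 e0 f) fe0. Qed.

Let row_b_e i : i \in e -> row i b = row i t.
Proof. by rewrite -b_e row_mask => ->. Qed.

Let row_b_Ce i : i \notin e -> (row i b <= mask f *m N)%MS.
Proof. by move=> ie; rewrite -b_Ce; apply: (eq_row_sub i); rewrite row_mask inE ie. Qed.

(** The tuples of vectors of [b] that use every vector normal to [e]; the vectors left over are then
    tangent to [e]. *)
Definition star_index (phi : 'I_k -> 'I_d.+1) : Prop :=
  [/\ injective phi, forall i, phi i \in f :\ e0
    & f :\: e \subset [set phi i | i : 'I_k]].

(** Up to sign, the wedge of the vectors of index [phi] is the Hodge star of the wedge of the left
    over vectors, which is a form of [e]. The complementary minor formula verifies this on every
    orthonormal basis. *)
Lemma star_Alt_det_form phi : star_index phi ->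
  star_Alt v o k f e (fun u => \det (u *m (rowsub phi b)^T)).
Proof.
case=> inj_phi phif sub_phi.
have [phi' inj' im'] := injection_complement _ _ _ _ _ inj_phi phif cardD1_face.
set x0 := rowsub phi' b; set y0 := rowsub phi b.
have on0 : orthonormal_basis (tangent v f) (col_mx x0 y0).
  exact: orthonormal_split b_gram b_tangent inj' inj_phi phif im'.
pose s0 := basis_sign v o f (col_mx x0 y0).
have x0e : (x0 <= tangent v e)%MS.
  apply: rowsub_sub => i.
  have : phi' i \in (f :\ e0) :\: [set phi i | i : 'I_k] by rewrite -im' imset_f.
  case/setDP=> /setD1P[_ fi] nphi.
  have ei : phi' i \in e.
    by apply: contraR nphi => ei; apply: (subsetP sub_phi); rewrite inE ei.
  by rewrite row_b_e // -(frame_tangent _ _ _ _ _ _ fr) row_sub.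
(* The factor [s0] cancels the sign of the reference basis, since its square is 1. *)
exists (fun x => s0 * \det (x *m x0^T)).
  have [[la za] aP] := (AltP _ _ _ _ _ (frame_gram _ _ _ _ _ _ fr)
    (frame_tangent _ _ _ _ _ _ fr)).1 (det_form_Alt _ _ _ _ _ _
    (frame_gram _ _ _ _ _ _ fr) (frame_tangent _ _ _ _ _ _ fr) x0e).
  apply/(AltP _ _ _ _ _ (frame_gram _ _ _ _ _ _ fr)
    (frame_tangent _ _ _ _ _ _ fr)); split; last by move=> u; rewrite aP.
  split=> [u w1 w2 i c1 c2 h1 h2 h3 h4 h5 h6|u i j h1 h2 h3].
    by rewrite (la _ _ _ _ _ _ h1 h2 h3 h4 h5 h6); ring.
  by rewrite (za _ _ _ h1 h2 h3) mulr0.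
split=> [|x y on].
  apply: (det_form_Alt _ _ _ _ _ _ b_gram b_tangent).
  by rewrite -b_tangent rowsub_sub // => i; apply: row_sub.
have dn : (sdim f - k + k)%N = sdim f by rewrite subnK.
have [-> s2] := basis_sign_change _ _ o _ _ _ f_neq0 dn on on0.
have [_ QQ] := orthonormal_change _ _ _ _ on on0.
rewrite -(orthogonal_complementary_minor _ _ _ _ _ _ QQ).
by rewrite -/s0 in s2 *; rewrite -mulrA (mulrA s0) -expr2 s2 mul1r.
Qed.

(** If [phi] misses an index of [f :\: e], the complementary tuple contains a vector normal to [e],
    and a form of [e] vanishes on it. *)
Lemma star_Alt_coef c (phi : {ffun 'I_k -> 'I_d.+1}) :
  star_Alt v o k f e c -> c (rowsub phi b) != 0 -> star_index phi.
Proof.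
case=> a /(AltP _ _ _ _ _ (frame_gram _ _ _ _ _ _ fr)
  (frame_tangent _ _ _ _ _ _ fr))[aa aP] [cAlt ca] nz.
have [inj_phi phif] := Alt_coef _ _ _ _ _ _ _ b_gram b_tangent cAlt nz.
split=> //; apply/subsetP=> x /setDP[fx ex]; apply: contraR nz => nx; apply/eqP.
have [phi' inj' im'] := injection_complement _ _ _ _ _ inj_phi phif cardD1_face.
rewrite (ca (rowsub phi' b)); last first.
  exact: orthonormal_split b_gram b_tangent inj' inj_phi phif im'.
have /imsetP[i _ xi] : x \in [set phi' i | i : 'I_(sdim f - k)].
  by rewrite im' 3!inE nx fx !andbT; apply: contraNneq ex => ->.
rewrite -aP (alternating_row0 _ _ i aa) ?mulr0 //.
rewrite row_mul row_rowsub -xi; have /submxP[X ->] := row_b_Ce _ ex.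
by rewrite -!mulmxA (mulmxA N) (frame_orth _ _ _ _ _ _ fr) mul0mx !mulmx0.
Qed.

Lemma star_Alt_expand c : star_Alt v o k f e c ->
  forall u, c u = k`!%:R^-1 * \sum_(phi : {ffun 'I_k -> 'I_d.+1})
    c (rowsub phi b) * \det (u *m (rowsub phi b)^T).
Proof.
by case=> a _ [cAlt _]; apply: Alt_expand b_gram b_tangent cAlt.
Qed.

(** The vertices outside [e] used by a tuple of dual vectors determine the face. The proof expands
    [c] in the basis [b] and shows that all determinants vanish for any other tuple. *)
Lemma star_Alt_dual c (psi : {ffun 'I_k -> 'I_d.+1}) :
  star_Alt v o k f e c -> c (rowsub psi (t + mask (~: e) *m G)) != 0 ->
  [set psi i | i : 'I_k] :\: e = f :\: e.
Proof.
set D := t + _ => cS; apply: contraNeq => ne; rewrite (star_Alt_expand _ cS).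
rewrite big1 ?mulr0 // => phi _.
have [->|nz] := eqVneq (c (rowsub phi b)) 0; first by rewrite mul0r.
have [inj_phi phif sub_phi] := star_Alt_coef _ _ cS nz.
apply/eqP; rewrite mulf_eq0; apply/orP; right.
have b_phi : (rowsub phi b <= tangent v f)%MS.
  by rewrite -b_tangent rowsub_sub // => i; apply: row_sub.
have rowD i : i \notin e -> row i D = row i G.
  move=> ie; rewrite raddfD /= row_mask inE ie.
  rewrite -(frame_mask_t _ fr e) ?subsetDl // row_mask.
  by rewrite (negPf ie) add0r.
(* An index of [psi] outside [f] contributes a gradient orthogonal to the tangent space of [f],
   hence a zero row of the matrix. *)
have [psif|] := boolP ([set psi i | i : 'I_k] :\: e \subset f); last first.
  case/subsetPn=> j /setDP[/imsetP[i _ ->] ei] nfi.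
  apply/det0P; exists (delta_mx 0 i).
    by apply/eqP=> /matrixP/(_ 0 i); rewrite !mxE !eqxx => /eqP; rewrite oner_eq0.
  rewrite mulmxA -rowE row_rowsub rowD //; apply: trmx_inj.
  rewrite trmx_mul trmxK trmx0.
  exact: gradient_tangent (frame_grad _ _ _ _ _ _ fr) nfi b_phi.
(* Otherwise [psi] misses some [x] of [f :\: e]. Then [row x N] is a nontrivial combination of the
   rows of [rowsub phi b] and is orthogonal to all dual vectors of index in [psi]; its coefficients
   [z] form a null vector. *)
have [x fx npsi] : exists2 x, x \in f :\: e & x \notin [set psi i | i : 'I_k].
  apply/subsetPn; apply: contra ne => sub.
  by rewrite eqEsubset !subsetD psif sub !disjoints_subset !setDE !subsetIr.
have [fx' ex] := setDP fx.
have /submxP[z Nz] : (row x N <= rowsub phi b)%MS.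
  have : (row x N <= mask f *m N)%MS.
    by apply: (eq_row_sub x); rewrite row_mask fx'.
  rewrite -b_Ce => /submx_trans; apply; apply/row_subP=> i; rewrite row_mask inE.
  case: ifP => [ei|_]; last exact: sub0mx.
  have [fi|nfi] := boolP (i \in f).
    by apply: row_rowsub_sub; apply: (subsetP sub_phi); rewrite inE ei.
  rewrite -(gram_mask_row _ _ b_gram) row_mask !inE (negPf nfi) andbF.
  exact: sub0mx.
have NG : row x N *m (row x G)^T = 1%:M.
  rewrite row_mul_tr; have /matrixP/(_ x x) := frame_dual _ _ _ _ _ _ fr.
  by rewrite mul_maskE maskE inE ex eqxx mulr1 => ->.
rewrite -det_tr; apply/det0P; exists z.
  apply: contraTneq isT => z0; move: NG; rewrite Nz z0 !mul0mx => /matrixP/(_ 0 0).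
  by rewrite !mxE => /eqP; rewrite eq_sym oner_eq0.
rewrite trmx_mul trmxK mulmxA -Nz; apply: trmx_inj; rewrite trmx_mul trmxK trmx0.
apply/row_matrixP=> i; rewrite row_mul row_rowsub row0.
have [ei|ei] := boolP (psi i \in e).
  rewrite raddfD /= row_mask inE ei addr0 row_mul_tr.
  have -> : t *m N^T = 0.
    by apply: trmx_inj; rewrite trmx_mul trmxK (frame_orth _ _ _ _ _ _ fr) trmx0.
  by rewrite mxE raddf0.
rewrite rowD //; apply: trmx_inj; rewrite trmx_mul trmxK trmx0 row_mul_tr.
have /matrixP/(_ x (psi i)) := frame_dual _ _ _ _ _ _ fr.
rewrite mul_maskE maskE inE ei mulr1 => ->.
case: eqP => [xi|_]; last exact: raddf0.
by move: npsi; rewrite xi imset_f.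
Qed.

End OneFace.
End StarAlt.

(** * Linear spans and polynomial functions *)

Section LinearSpans.
Context {R : realType} {E : lmodType R}.
Implicit Types S T : E -> Prop.

Definition linear_subspace T : Prop :=
  T 0 /\ forall (c : R) x y, T x -> T y -> T (c *: x + y).

Lemma subspaceZ T c x : linear_subspace T -> T x -> T (c *: x).
Proof. by case=> T0 TD Tx; rewrite -[_ *: _]addr0; apply: TD. Qed.

Lemma subspaceD T x y : linear_subspace T -> T x -> T y -> T (x + y).
Proof. by case=> T0 TD Tx Ty; rewrite -[x]scale1r; apply: TD. Qed.

Lemma subspace_sum T (J : Type) (s : seq J) (P : pred J) (F : J -> E) :
  linear_subspace T -> (forall j, P j -> T (F j)) -> T (\sum_(j <- s | P j) F j).
Proof.
by move=> sT TF; apply: big_ind => //; [case: sT | move=> x y; apply: subspaceD].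
Qed.

Lemma sub_lin_span S x : S x -> lin_span S x.
Proof.
by move=> Sx; exists 1%N, (fun=> 1), (fun=> x); rewrite big_ord1 scale1r.
Qed.

Lemma lin_span_subspace S : linear_subspace (lin_span S).
Proof.
split=> [|c x y [n [cx [wx [Sx ->]]]] [m [cy [wy [Sy ->]]]]].
  by exists 0%N, (fun=> 0), (fun=> 0); split; [case | rewrite big_ord0].
exists (n + m)%N.
exists (fun i => match split i with inl j => c * cx j | inr j => cy j end).
exists (fun i => match split i with inl j => wx j | inr j => wy j end).
split=> [i|]; first by case: (split i).
rewrite big_split_ord scaler_sumr /=; congr (_ + _); apply: eq_bigr => i _.
  by rewrite (unsplitK (inl i)) scalerA.
by rewrite (unsplitK (inr i)).
Qed.

Lemma lin_span_min S T : linear_subspace T -> (forall x, S x -> T x) ->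
  forall x, lin_span S x -> T x.
Proof.
move=> sT ST _ [n [c [y [Sy ->]]]]; apply: subspace_sum => // i _.
by apply: subspaceZ => //; apply: ST.
Qed.

Context {I : finType}.
Implicit Types (P : {set I}) (W : I -> E -> Prop).

Lemma sum_space_subspace P W :
  (forall i, linear_subspace (W i)) -> linear_subspace (sum_space P W).
Proof.
move=> sW; split=> [|c x y [wx Wx ->] [wy Wy ->]].
  by exists (fun=> 0); rewrite ?big1 // => i _; case: (sW i).
exists (fun i => c *: wx i + wy i) => [i Pi|].
  by case: (sW i) => _; apply; [apply: Wx | apply: Wy].
by rewrite big_split scaler_sumr.
Qed.

Lemma sub_sum_space P W i x :
  (forall i, linear_subspace (W i)) -> i \in P -> W i x -> sum_space P W x.
Proof.
move=> sW Pi Wx; exists (fun j => if j == i then x else 0) => [j Pj|].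
  by case: eqP => [->|_] //; case: (sW j).
rewrite (bigD1 i) //= eqxx big1 ?addr0 // => j /andP[_ /negPf->].
by [].
Qed.

Lemma eq_sum_space P W W' :
  (forall i, i \in P -> W i = W' i) -> sum_space P W = sum_space P W'.
Proof.
by move=> eW; apply/seteqP; split=> x [w Ww ->]; exists w => // i Pi;
  move: (Ww i Pi); rewrite eW.
Qed.

Lemma eq_direct_family P W W' : (forall i, i \in P -> W i = W' i) ->
  direct_family P W -> direct_family P W'.
Proof. by move=> eW dW w Ww; apply: dW => i Pi; rewrite eW //; apply: Ww. Qed.

End LinearSpans.

(** * Polynomials as functions *)

Section PolynomialFunctions.
Context {R : realType}.

(** Uniqueness of the expansion in base [N]: the lowest digit is the residue modulo [N], and the
    others follow after division by [N]. *)
Lemma digits_inj N n (a b : 'I_n -> nat) :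
  (forall i, (a i < N)%N) -> (forall i, (b i < N)%N) ->
  (\sum_i a i * N ^ i = \sum_i b i * N ^ i)%N -> a =1 b.
Proof.
elim: n a b => [|n IHn] a b aN bN; first by move=> _ [].
have rec (c : 'I_n.+1 -> nat) : (\sum_i c i * N ^ i
    = c ord0 + N * \sum_(i < n) c (lift ord0 i) * N ^ i)%N.
  rewrite big_ord_recl expn0 muln1 big_distrr /=; congr addn.
  by apply: eq_bigr => i _; rewrite /bump /= add1n expnS; lia.
rewrite !rec => e.
have N0 : (0 < N)%N by apply: leq_ltn_trans (aN ord0).
have e0 : a ord0 = b ord0.
  have := congr1 (modn^~ N) e; rewrite /= !(mulnC N).
  by rewrite ![(_ + _ * N)%N]addnC !modnMDl !modn_small.
move: e; rewrite e0 => /addnI/eqP; rewrite eqn_pmul2l // => /eqP {}e i.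
case: (unliftP ord0 i) => [j ->|-> //].
by apply: (IHn (fun j => a (lift ord0 j)) (fun j => b (lift ord0 j))).
Qed.

(** A nonzero [p] would have [size p] distinct natural numbers among its roots. *)
Lemma poly_vanish (p : {poly R}) : (forall x, p.[x] = 0) -> p = 0.
Proof.
move=> p0; apply/eqP/negP => /negP nz.
have := max_poly_roots nz (rs := [seq i%:R | i <- iota 0 (size p)]).
rewrite size_map size_iota ltnn => /(_ _ _)/implyP.
have -> : all (root p) [seq i%:R | i <- iota 0 (size p)].
  by apply/allP=> x _; rewrite rootE p0.
rewrite map_inj_uniq ?iota_uniq; first by move=> h; have := h isT isT.
by move=> i j /eqP; rewrite eqr_nat => /eqP.
Qed.

(* Kronecker's substitution X_i := y ^ (N ^ i). *)
Lemma mpoly_vanish n (p : {mpoly R[n]}) : (forall x, p.@[x] = 0) -> p = 0.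
Proof.
(* [N] exceeds every exponent occurring in [p], so the substitution sends distinct monomials of [p]
   to distinct powers. *)
move=> p0; pose N := (msize p).+1.
pose w (m : 'X_{1..n}) := (\sum_i m i * N ^ i)%N.
have w_inj m m' : m \in msupp p -> m' \in msupp p -> w m = w m' -> m = m'.
  move=> sm sm' e; apply/mnmP.
  have lt (m1 : 'X_{1..n}) i : m1 \in msupp p -> (m1 i < N)%N.
    move/msize_mdeg_lt; rewrite mdegE (bigD1 i) //= => h.
    by rewrite ltnS; apply: leq_trans (ltnW h); rewrite leq_addr.
  by apply: (@digits_inj N _ m m') => // i; apply: lt.
pose q : {poly R} := \sum_(m <- msupp p) p@_m *: 'X^(w m).
have q0 : q = 0.
  apply: poly_vanish => y; rewrite -[RHS](p0 (fun i => y ^+ (N ^ i))) mevalE.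
  rewrite horner_sum; apply: eq_bigr => m _; rewrite hornerZ hornerXn.
  congr (_ * _); rewrite /w -prodrXr; apply: eq_bigr => i _.
  by rewrite -exprM mulnC.
apply/mpolyP=> m; rewrite mcoeff0; apply/eqP; rewrite -[_ == 0]negbK -mcoeff_msupp.
apply/negP=> sm; have := congr1 (coefp (w m)) q0; rewrite /= coef0 /q coef_sum.
rewrite (bigD1_seq m) ?msupp_uniq //= coefZ coefXn eqxx mulr1 big_seq_cond big1.
  by rewrite addr0 => /eqP; apply/negP; rewrite -mcoeff_msupp.
move=> m' /andP[sm' ne]; rewrite coefZ coefXn.
by case: eqP => [/(w_inj _ _ sm sm') e|]; [rewrite e eqxx in ne | rewrite mulr0].
Qed.

Lemma meval_sum n (x : 'I_n -> R) (J : Type) (s : seq J) (P : pred J)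
    (F : J -> {mpoly R[n]}) :
  (\sum_(j <- s | P j) F j).@[x] = \sum_(j <- s | P j) (F j).@[x].
Proof. exact: (raddf_sum (meval x)). Qed.

Lemma dhomog_evalZ n r (Q : {mpoly R[n]}) c x :
  Q \is r.-homog -> Q.@[fun i => c * x i] = c ^+ r * Q.@[x].
Proof.
move/dhomogP=> hQ; rewrite !mevalE mulr_sumr !big_seq; apply: eq_bigr => m sm.
rewrite mulrCA; congr (_ * _); under eq_bigr do rewrite exprMn.
by rewrite big_split /= prodrXr -(hQ _ sm) /= mdegE.
Qed.

Lemma affine_mpolyE n (q : {mpoly R[n]}) : (msize q <= 2)%N ->
  q = (q@_0%MM)%:MP + \sum_j q@_U_(j)%MM *: 'X_j.
Proof.
move=> sq; apply/mpolyP=> m; rewrite mcoeffD mcoeffC raddf_sum /=.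
under eq_bigr do rewrite mcoeffZ mcoeffX.
case: (eqVneq m 0%MM) => [->|nm0].
  rewrite mulr1 big1 ?addr0 // => j _.
  by rewrite mnm1_eq0 mulr0.
rewrite mulr0 add0r.
have [|] := boolP (mdeg m == 1%N).
  case/mdeg1P=> j /eqP ->; rewrite (bigD1 j) //= eqxx mulr1 big1 ?addr0 // => l lj.
  by rewrite eq_mnm1 (negPf lj) mulr0.
move=> m1; rewrite (memN_msupp_eq0 (msize_mdeg_ge _)); last first.
  apply: leq_trans sq _; rewrite -mdeg_eq0 in nm0.
  by case: (mdeg m) nm0 m1 => [|[|]].
rewrite big1 // => j _; case: eqP => [e|_]; last by rewrite mulr0.
by rewrite -e mdeg1 in m1.
Qed.

End PolynomialFunctions.

(** * Bernstein polynomials *)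

Section BernsteinPolynomials.
Context {R : realType} {d : nat}.
Variables (v : 'I_d.+1 -> 'rV[R]_d) (lam : 'I_d.+1 -> {mpoly R[d]}).
Implicit Types (e f : {set 'I_d.+1}) (p q : {mpoly R[d]}).

Lemma poly_deg_le_subspace r : linear_subspace (@poly_deg_le R d r).
Proof.
split=> [|c x y sx sy]; first by rewrite /poly_deg_le /= msize0.
apply: leq_trans (msizeD_le _ _) _; rewrite geq_max sy andbT.
exact: leq_trans (msizeZ_le _ _) sx.
Qed.

Lemma poly_deg_leM a b p q :
  poly_deg_le a p -> poly_deg_le b q -> poly_deg_le (a + b)%N (p * q).
Proof.
rewrite /poly_deg_le /= => sp sq.
have [->|p0] := eqVneq p 0; first by rewrite mul0r msize0.
have [->|q0] := eqVneq q 0; first by rewrite mulr0 msize0.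
rewrite msizeM //; have := leq_add sp sq; rewrite addnS addSn.
by case: (_ + msize q)%N.
Qed.

Lemma affine_eval q t : (msize q <= 2)%N -> \sum_j t j = 1 ->
  q.@[fun l => \sum_j t j * v j ord0 l] = \sum_j t j * q.@[v j ord0].
Proof.
move=> /affine_mpolyE -> t1.
have ev x : ((q@_0%MM)%:MP + \sum_j q@_U_(j)%MM *: 'X_j).@[x]
    = q@_0%MM + \sum_j q@_U_(j)%MM * x j.
  rewrite mevalD mevalC meval_sum; congr (_ + _).
  by apply: eq_bigr => j _; rewrite mevalZ mevalXU.
rewrite ev; under [RHS]eq_bigr do rewrite ev mulrDr.
rewrite big_split -mulr_suml t1 mul1r /=; congr (_ + _).
under [RHS]eq_bigr do rewrite mulr_sumr.
rewrite exchange_big; apply: eq_bigr => l _; rewrite mulr_sumr.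
by apply: eq_bigr => j _; rewrite mulrCA.
Qed.

Hypothesis v_affine : affinely_independent v.

(** The differences of the values at the vertices show that the invertible matrix [U] kills the
    linear part; the constant term then vanishes as well. *)
Lemma affine_eq0 q : (msize q <= 2)%N -> (forall j, q.@[v j ord0] = 0) -> q = 0.
Proof.
move=> /affine_mpolyE eq0 q0.
have ev x : q.@[x] = q@_0%MM + \sum_j q@_U_(j)%MM * x j.
  rewrite {1}eq0 mevalD mevalC meval_sum; congr (_ + _).
  by apply: eq_bigr => j _; rewrite mevalZ mevalXU.
set U := \matrix_(i < d) (v (lift ord0 i) - v ord0).
have uU : U \in unitmx by rewrite -row_free_unit.
pose c : 'cV[R]_d := \col_j q@_U_(j)%MM.
have Uc : U *m c = 0.
  apply/matrixP=> i j; rewrite !mxE.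
  have := q0 (lift ord0 i); rewrite -[RHS](q0 ord0) !ev => /addrI/eqP.
  rewrite -subr_eq0 -sumrB => /eqP h; rewrite -[RHS]h.
  by apply: eq_bigr => l _; rewrite !mxE mulrBl !(mulrC q@__).
have c0 : c = 0 by rewrite -(mulKmx uU c) Uc mulmx0.
have cj j : q@_U_(j)%MM = 0 by move/matrixP: c0 => /(_ j 0); rewrite !mxE.
rewrite eq0 big1 => [|j _]; last by rewrite cj scale0r.
have := q0 ord0; rewrite ev big1 => [|j _]; last by rewrite cj mul0r.
by rewrite !addr0 => ->; rewrite mpolyC0.
Qed.

Hypothesis lamP : barycentric v lam.

Lemma lam_deg i : poly_deg_le 1 (lam i).
Proof. by case: (lamP i). Qed.

Lemma affine_lam q :
  (msize q <= 2)%N -> q = \sum_i q.@[v i ord0] *: lam i.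
Proof.
move=> sq; apply/eqP; rewrite -subr_eq0; apply/eqP/affine_eq0 => [|j].
  apply: (subspaceD _ _ _ (poly_deg_le_subspace 1)) => //.
  rewrite -scaleN1r; apply: (subspaceZ _ _ _ (poly_deg_le_subspace 1)).
  apply: (subspace_sum _ _ _ _ _ (poly_deg_le_subspace 1)) => i _.
  by apply: (subspaceZ _ _ _ (poly_deg_le_subspace 1)); apply: lam_deg.
rewrite mevalB meval_sum (bigD1 j) //= mevalZ (lamP j).2 eqxx mulr1.
rewrite big1 ?addr0 ?subrr // => i /negPf ij.
by rewrite mevalZ (lamP i).2 ij mulr0.
Qed.

Lemma lam_eval t i : \sum_j t j = 1 ->
  (lam i).@[fun l => \sum_j t j * v j ord0 l] = t i.
Proof.
move=> t1; rewrite (affine_eval _ _ (lam_deg i) t1) (bigD1 i) //=.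
rewrite (lamP i).2 eqxx mulr1 big1 ?addr0 // => j /negPf ji.
by rewrite (lamP i).2 eq_sym ji mulr0.
Qed.

(** Any tuple of sum 1 consists of the barycentric coordinates of some point, so [Q] vanishes on it,
    and by homogeneity on every tuple of nonzero sum. *)
Lemma homog_lam_inj r (Q : {mpoly R[d.+1]}) :
  Q \is r.-homog -> Q \mPo [tuple lam i | i < d.+1] = 0 -> Q = 0.
Proof.
move=> hQ Q0.
have Q1 t : \sum_j t j = 1 -> Q.@[t] = 0.
  move=> t1; have := congr1 (meval (fun l => \sum_j t j * v j ord0 l)) Q0.
  rewrite comp_mpoly_meval meval0 => <-; apply: meval_eq => i.
  by rewrite tnth_mktuple lam_eval.
(* The linear factor takes care of the tuples of sum 0, which cannot be rescaled to sum 1. *)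
have : Q * \sum_i 'X_i = 0.
  apply: mpoly_vanish => s; rewrite mevalM meval_sum.
  under eq_bigr do rewrite mevalXU.
  have [->|s0] := eqVneq (\sum_i s i) 0; first by rewrite mulr0.
  have -> : Q.@[s] = Q.@[fun i => (\sum_i s i) * ((\sum_i s i)^-1 * s i)].
    by apply: meval_eq => i; rewrite mulVKf.
  by rewrite (dhomog_evalZ _ _ _ _ _ hQ) Q1 ?mulr0 ?mul0r // -mulr_sumr mulVf.
move/eqP; rewrite mulf_eq0 => /orP[/eqP //|/eqP X0].
have := congr1 (meval (fun i => (i == ord0)%:R)) X0.
rewrite meval0 meval_sum (bigD1 ord0) //= mevalXU eqxx big1 => [|i /negPf i0].
  by rewrite addr0 => /eqP; rewrite oner_eq0.
by rewrite mevalXU i0.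
Qed.

Lemma Bernstein_subspace m e : linear_subspace (Bernstein lam m e).
Proof. exact: lin_span_subspace. Qed.

Lemma monomial_deg e (alpha : 'I_d.+1 -> nat) :
  poly_deg_le (\sum_(i in e) alpha i)%N (\prod_(i in e) lam i ^+ alpha i).
Proof.
have degX i n : poly_deg_le n (lam i ^+ n).
  elim: n => [|n IHn]; first by rewrite expr0 /poly_deg_le /= msize1.
  by rewrite exprS -add1n; apply: poly_deg_leM => //; apply: lam_deg.
by apply: (big_ind2 (fun a p => poly_deg_le a p)) => //;
  [rewrite /poly_deg_le /= msize1 | move=> *; apply: poly_deg_leM].
Qed.

Lemma bubble_monomial e (alpha : 'I_d.+1 -> nat) :
  bubble lam e * (\prod_(i in e) lam i ^+ alpha i) =
  \prod_(i in e) lam i ^+ (alpha i).+1.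
Proof.
by rewrite /bubble -big_split; apply: eq_bigr => i _; rewrite exprS.
Qed.

Lemma bubble_degree r e (alpha : 'I_d.+1 -> nat) :
  (\sum_(i in e) alpha i)%N%:Z = r%:Z - #|e|%:Z ->
  (\sum_(i in e) (alpha i).+1)%N = r.
Proof.
move=> ea; under eq_bigr do rewrite -addn1.
by rewrite big_split /= sum1_card; apply/eqP; rewrite -eqz_nat PoszD ea subrK.
Qed.

Lemma bubble_Bernstein_deg r e q :
  Bernstein lam (r%:Z - #|e|%:Z) e q -> poly_deg_le r (bubble lam e * q).
Proof.
apply: (lin_span_min _ (fun q => poly_deg_le r (bubble lam e * q))).
  split=> [|c x y]; first by rewrite mulr0 /poly_deg_le /= msize0.
  rewrite mulrDr -scalerAr; apply: (proj2 (poly_deg_le_subspace r)).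
move=> _ [alpha /bubble_degree <- ->]; rewrite bubble_monomial.
exact: monomial_deg.
Qed.

Lemma bubble_Bernstein_sub r e f q : e \subset f ->
  Bernstein lam (r%:Z - #|e|%:Z) e q -> Bernstein lam r%:Z f (bubble lam e * q).
Proof.
move=> sef; have sub := Bernstein_subspace r%:Z f.
apply: (lin_span_min _ (fun q => Bernstein lam r%:Z f (bubble lam e * q))).
  split=> [|c x y]; first by rewrite mulr0; case: sub.
  by rewrite mulrDr -scalerAr; case: sub => _; apply.
move=> _ [alpha /bubble_degree er ->]; rewrite bubble_monomial.
apply: sub_lin_span; exists (fun i => if i \in e then (alpha i).+1 else 0%N).
  rewrite -er (big_setID e) /= (setIidPr sef) [X in (_ + X)%N]big1 => [|i].
    by rewrite addn0; congr Posz; apply: eq_bigr => i ->.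
  by rewrite inE => /andP[/negPf->].
rewrite [RHS](big_setID e) /= (setIidPr sef) [X in _ * X]big1 => [|i].
  by rewrite mulr1; apply: eq_bigr => i ->.
by rewrite inE => /andP[/negPf->]; rewrite expr0.
Qed.

Lemma Bernstein_mul a b p q :
  Bernstein lam a%:Z [set: 'I_d.+1] p -> Bernstein lam b%:Z [set: 'I_d.+1] q ->
  Bernstein lam (a + b)%N%:Z [set: 'I_d.+1] (p * q).
Proof.
move=> Bp; have sub := Bernstein_subspace (a + b)%N%:Z [set: 'I_d.+1].
apply: (lin_span_min _ (fun q => Bernstein _ _ _ (p * q))).
  split=> [|c x y]; first by rewrite mulr0; case: sub.
  by rewrite mulrDr -scalerAr; case: sub => _; apply.
move=> _ [beta eb ->]; move: p Bp.
apply: (lin_span_min _ (fun p => Bernstein _ _ _ (p * _))).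
  split=> [|c x y]; first by rewrite mul0r; case: sub.
  by rewrite mulrDl -scalerAl; case: sub => _; apply.
move=> _ [alpha ea ->]; apply: sub_lin_span.
exists (fun i => alpha i + beta i)%N; first by case: ea eb => + [+]; rewrite big_split /= => -> ->.
by rewrite -big_split; apply: eq_bigr => i _; rewrite exprD.
Qed.

Lemma Bernstein_affine q :
  (msize q <= 2)%N -> Bernstein lam 1 [set: 'I_d.+1] q.
Proof.
move/affine_lam ->; apply: (subspace_sum _ _ _ _ _ (Bernstein_subspace _ _)) => i _.
apply: (subspaceZ _ _ _ (Bernstein_subspace _ _)); apply: sub_lin_span.
exists (fun j => (j == i) : nat).
  rewrite (bigD1 i) ?inE //= eqxx big1 => [|j /andP[_ /negPf->] //].
  by rewrite addn0.
rewrite (bigD1 i) ?inE //= eqxx expr1 big1 ?mulr1 // => j /andP[_ /negPf->].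
by rewrite expr0.
Qed.

Lemma Bernstein_exp q n :
  (msize q <= 2)%N -> Bernstein lam n%:Z [set: 'I_d.+1] (q ^+ n).
Proof.
move=> sq; elim: n => [|n IHn].
  rewrite expr0; apply: sub_lin_span; exists (fun=> 0%N); first by rewrite big1.
  by rewrite big1 // => i _; rewrite expr0.
by rewrite exprS -add1n; apply: Bernstein_mul => //; apply: Bernstein_affine.
Qed.

(** A monomial of degree at most [r] is a product of [r] affine factors once padded with powers of
    the constant 1, itself the sum of the barycentric coordinates. *)
Lemma Bernstein_full r p :
  poly_deg_le r p -> Bernstein lam r%:Z [set: 'I_d.+1] p.
Proof.
rewrite /poly_deg_le /= => sp; rewrite (mpolyE p) big_seq.
apply: (subspace_sum _ _ _ _ _ (Bernstein_subspace _ _)) => m sm.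
apply: (subspaceZ _ _ _ (Bernstein_subspace _ _)).
have ler : (mdeg m <= r)%N.
  by have := leq_trans (msize_mdeg_lt sm) sp; rewrite ltnS.
rewrite -(subnKC ler) -['X_[m]]mulr1 -(expr1n _ (r - mdeg m)).
apply: Bernstein_mul; last by apply: Bernstein_exp; rewrite msize1.
rewrite mpolyXE_id mdegE; apply: (big_ind2 (fun (a : nat) p => Bernstein lam a%:Z _ p)).
- by rewrite -[1](expr0 1); apply: Bernstein_exp; rewrite msize1.
- by move=> *; apply: Bernstein_mul.
- by move=> i _; apply: Bernstein_exp; rewrite msizeX mdeg1.
Qed.

(** Lifts to homogeneous polynomials in [d.+1] independent variables, where the support of any
    monomial recovers [e]. *)
Lemma bubble_Bernstein_homog r e q : Bernstein lam (r%:Z - #|e|%:Z) e q ->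
  exists Q : {mpoly R[d.+1]},
  [/\ Q \is r.-homog, bubble lam e * q = Q \mPo [tuple lam i | i < d.+1] &
    forall m, Q@_m != 0 -> e = [set i | m i != 0%N]].
Proof.
move: q; apply: lin_span_min.
  split=> [|c x y [Q [hQ eQ sQ]] [Q' [hQ' eQ' sQ']]].
    exists 0; split; rewrite ?dhomog0 ?mulr0 ?comp_mpoly0 // => m.
    by rewrite mcoeff0 eqxx.
  exists (c *: Q + Q'); split.
  - by rewrite dhomogD // dhomogZ.
  - by rewrite mulrDr -scalerAr eQ eQ' comp_mpolyD comp_mpolyZ.
  move=> m; rewrite mcoeffD mcoeffZ => nz.
  have [Q0|] := eqVneq Q@_m 0; last exact: sQ.
  by apply: sQ'; move: nz; rewrite Q0 mulr0 add0r.
move=> _ [alpha /bubble_degree er ->]; rewrite bubble_monomial.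
pose m := [multinom (if i \in e then (alpha i).+1 else 0%N) | i < d.+1].
exists 'X_[m]; split.
- rewrite dhomogX -er [X in _ == X]big_mkcond /= mdegE; apply/eqP/eq_bigr => i _.
  by rewrite mnmE.
- rewrite comp_mpolyX big_mkcond; apply: eq_bigr => i _.
  by rewrite tnth_mktuple mnmE; case: ifP.
- move=> m'; rewrite mcoeffX; case: (m =P m') => [<- _|_]; last by rewrite eqxx.
  by apply/setP=> i; rewrite inE mnmE; case: ifP.
Qed.

(** The homogeneous lifts also sum to 0, and those of distinct faces have no monomial in common. *)
Lemma bubble_Bernstein_direct r (p : {set 'I_d.+1} -> {mpoly R[d]}) :
  (forall e, exists2 q, Bernstein lam (r%:Z - #|e|%:Z) e q & p e = bubble lam e * q) ->
  \sum_e p e = 0 -> forall e, p e = 0.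
Proof.
move=> pP p0.
have hom e : exists Q : {mpoly R[d.+1]},
  [/\ Q \is r.-homog, p e = Q \mPo [tuple lam i | i < d.+1] &
    forall m, Q@_m != 0 -> e = [set i | m i != 0%N]].
  by have [q Bq ->] := pP e; apply: bubble_Bernstein_homog.
have [Q QP] := choice hom.
have Q0 : \sum_e Q e = 0.
  apply: (homog_lam_inj r); first by apply: rpred_sum => e _; case: (QP e).
  by rewrite raddf_sum -[RHS]p0; apply: eq_bigr => e _; case: (QP e).
move=> e; have [_ -> eQ] := QP e; suff -> : Q e = 0 by rewrite comp_mpoly0.
apply/mpolyP=> m; rewrite mcoeff0; apply/eqP; apply: contraT => nz.
have := congr1 (mcoeff m) Q0; rewrite raddf_sum mcoeff0 /= (bigD1 e) //= big1.
  by rewrite addr0 => /eqP; rewrite (negPf nz).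
move=> e' ne; apply/eqP; apply: contraNT ne => nz'.
have [_ _ eQ'] := QP e'.
by rewrite (eQ _ nz) -(eQ' _ nz').
Qed.

(** One factor is taken out for each vertex of positive exponent; this assigns every Bernstein
    monomial to the face that supports it. *)
Lemma monomial_support f (alpha : 'I_d.+1 -> nat) (r : nat) :
  (\sum_(i in f) alpha i)%N%:Z = r%:Z ->
  let e := [set i in f | alpha i != 0%N] in
  exists2 q, Bernstein lam (r%:Z - #|e|%:Z) e q &
    \prod_(i in f) lam i ^+ alpha i = bubble lam e * q.
Proof.
move=> ea e; have sef : e \subset f by apply/subsetP=> i; rewrite inE => /andP[].
have fe i : i \in f -> i \notin e -> alpha i = 0%N.
  by move=> fi; rewrite inE fi negbK => /eqP.
exists (\prod_(i in e) lam i ^+ (alpha i).-1); last first.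
  rewrite bubble_monomial (big_setID e) /= (setIidPr sef).
  rewrite [X in _ * X]big1 => [|i /setDP[fi nei]]; last by rewrite fe.
  rewrite mulr1; apply: eq_bigr => i; rewrite inE => /andP[_].
  by rewrite -lt0n => /prednK ->.
apply: sub_lin_span; exists (fun i => (alpha i).-1) => //.
suff -> : r = (\sum_(i in e) (alpha i).-1 + #|e|)%N by rewrite PoszD addrK.
case: ea => <-; rewrite (big_setID e) /= (setIidPr sef).
rewrite [X in (_ + X)%N]big1 => [|i /setDP[fi nei]]; last by rewrite fe.
rewrite addn0 -sum1_card -big_split; apply: eq_bigr => i.
by rewrite inE => /andP[_]; rewrite -lt0n => ai /=; rewrite addn1 prednK.
Qed.

End BernsteinPolynomials.

(** * The decomposition of alternating forms *)

Section FaceDecomposition.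
Context {R : realType} {d : nat}.
Variable v : 'I_d.+1 -> 'rV[R]_d.
Implicit Types e f : {set 'I_d.+1}.

Lemma mem_bigcup_seq (J : Type) (s : seq J) (F : J -> {set {set 'I_d.+1}}) f :
  (f \in \bigcup_(j <- s) F j) = has (fun j => f \in F j) s.
Proof. by elim: s => [|j s IHs]; rewrite ?big_nil ?big_cons inE //= IHs. Qed.

Lemma faces_fromE k f : (f \in faces_from k) = (k < #|f|)%N.
Proof.
rewrite /faces_from mem_bigcup_seq; apply/hasP/idP => [[l]|lt].
  by rewrite mem_index_iota inE => /andP[lekl _] /andP[_ /eqP ->].
have f0 := leq_ltn_trans (leq0n k) lt.
exists #|f|.-1; last by rewrite inE subsetT prednK /=.
have := max_card (mem f); rewrite card_ord mem_index_iota => lef.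
by rewrite -ltnS prednK // lt.
Qed.

Lemma BLambda_facesE k f e : f != finset.set0 ->
  (e \in BLambda_faces k f) = (e \subset f) && (sdim f - k < #|e|)%N.
Proof.
rewrite -card_gt0 => f0; rewrite /BLambda_faces mem_bigcup_seq.
apply/hasP/idP => [[s]|/andP[sef lt]].
  by rewrite mem_index_iota inE => /andP[les _] /andP[-> /eqP ->].
have e0 := leq_ltn_trans (leq0n _) lt.
exists #|e|.-1; last by rewrite inE sef prednK /=.
rewrite mem_index_iota /sdim !prednK // subset_leq_card // andbT.
by rewrite -ltnS prednK.
Qed.

Hypothesis v_affine : affinely_independent v.
Context {k : nat}.

(** By duality of the two bases, [u *m (t + N)^T] holds the coordinates of [u] in the dual basis. *)
Lemma frame_expand e (e0 : 'I_d.+1) t N G (a : kform k) : frame v e e0 t N G ->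
  alternating_on 1%:M a ->
  forall u, a u = k`!%:R^-1 * \sum_(psi : {ffun 'I_k -> 'I_d.+1})
    a (rowsub psi (t + mask (~: e) *m G)) * \det (u *m (rowsub psi (t + N))^T).
Proof.
move=> fr aa u; rewrite -[in LHS](mulmx1 u) -trmx1 -(frame_dual_basis _ v_affine fr).
rewrite trmx_mul trmxK mulmxA alternating_expand //; congr (_ * _).
by apply: eq_bigr => psi _; rewrite trmx_mxsub mulmx_colsub.
Qed.

(** The same [D] and [M] serve all faces [f] containing [e], unlike the orthonormal bases of the
    tangent spaces of [f]; the forms of different faces can therefore be compared on common
    tuples. *)
Lemma star_Alt_dual_basis e : e != finset.set0 ->
  exists D M : 'M[R]_(d.+1, d), forall f o c,
    e \subset f -> (k <= sdim f)%N -> star_Alt v o k f e c ->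
    (forall u, c u = k`!%:R^-1 * \sum_(psi : {ffun 'I_k -> 'I_d.+1})
       c (rowsub psi D) * \det (u *m (rowsub psi M)^T)) /\
    (forall psi : {ffun 'I_k -> 'I_d.+1}, c (rowsub psi D) != 0 ->
       [set psi i | i : 'I_k] :\: e = f :\: e).
Proof.
case/set0Pn=> e0 ee0; have [t [N [G fr]]] := frame_exists _ v_affine _ _ ee0.
exists (t + mask (~: e) *m G), (t + N) => f o c sef lekf cS.
have [b [bb bf be bCe]] := face_basis _ fr _ sef.
split=> [u|psi].
  case: cS => a _ [/(AltP _ _ _ _ _ bb bf)[cc _] _].
  exact: frame_expand fr cc u.
exact: star_Alt_dual _ fr _ _ _ _ sef lekf bb bf bCe _ _ cS.
Qed.

(* The faces are indexed redundantly: several index maps phi give the same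
   face F phi. *)
Lemma alternating_star_sum (o : {set 'I_d.+1} -> bool) e (a : kform k) :
  e != finset.set0 -> alternating_on 1%:M a ->
  exists (F : {ffun 'I_k -> 'I_d.+1} -> {set 'I_d.+1})
         (x : {ffun 'I_k -> 'I_d.+1} -> R * kform k),
  (forall u, a u = \sum_phi (x phi).1 * (x phi).2 u) /\
  forall phi, (x phi).1 = 0 \/
    [/\ F phi \in faces_from k, e \in BLambda_faces k (F phi)
      & star_Alt v (o (F phi)) k (F phi) e (x phi).2].
Proof.
case/set0Pn=> e0 ee0 aa; have [t [N [G fr]]] := frame_exists _ v_affine _ _ ee0.
set D := t + mask (~: e) *m G; set M := t + N.
(* The vertices of this face outside [e] are exactly those used by the tuple. *)
pose F (phi : {ffun 'I_k -> 'I_d.+1}) := e :|: [set phi i | i : 'I_k].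
suff xP (phi : {ffun 'I_k -> 'I_d.+1}) : exists x : R * kform k,
    (forall u, k`!%:R^-1 * (a (rowsub phi D) * \det (u *m (rowsub phi M)^T))
      = x.1 * x.2 u) /\
    (x.1 = 0 \/ [/\ F phi \in faces_from k, e \in BLambda_faces k (F phi)
      & star_Alt v (o (F phi)) k (F phi) e x.2]).
  have [x {}xP] := choice xP; exists F, x; split=> [u|phi]; last by case: (xP phi).
  by rewrite (frame_expand _ _ _ _ _ _ fr aa) mulr_sumr; apply: eq_bigr => phi _; case: (xP phi) => ->.
(* When the coefficient is zero, [F phi] may have too few vertices, and the term is recorded as
   zero. *)
have [z|nz] := eqVneq (a (rowsub phi D)) 0.
  by exists (0, a); split=> [u|]; [rewrite z !mul0r mulr0 | left].
have inj_phi := alternating_inj _ _ _ _ aa nz.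
have phi_e0 i : phi i != e0.
  apply: contraNneq nz => ie0; apply/eqP/(alternating_row0 _ _ i aa).
  rewrite row_rowsub ie0 raddfD /= row_mask inE ee0 addr0.
  rewrite -(frame_mask_t _ fr (e :\ e0)) ?subxx // row_mask.
  by rewrite !inE eqxx.
have sef : e \subset F phi by apply: subsetUl.
have Fe0 : e0 \in F phi := subsetP sef _ ee0.
have card_im : #|[set phi i | i : 'I_k]| = k by rewrite card_imset // card_ord.
have ltkF : (k < #|F phi|)%N.
  rewrite (cardsD1 e0) Fe0 add1n ltnS -card_im; apply: subset_leq_card.
  by apply/subsetP=> _ /imsetP[i _ ->]; rewrite !inE phi_e0 imset_f ?orbT.
have F0 : F phi != finset.set0 by rewrite -card_gt0 (leq_ltn_trans _ ltkF).
have lekF : (k <= sdim (F phi))%N by rewrite /sdim -ltnS prednK // card_gt0.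
have [b [bb bf be bCe]] := face_basis _ fr _ sef.
have idx : @star_index _ e e0 k (F phi) phi.
  split=> // [i|]; first by rewrite !inE phi_e0 imset_f ?orbT.
  by rewrite /F setDUl setDv set0U subsetDl.
have phiS := star_Alt_det_form _ fr (o (F phi)) _ _ _ sef lekF bb bf be _ idx.
(* [M] and [b] agree on [e], and the rows of [M] normal to [e] are combinations of the normal rows
   of [b], all of which [phi] uses. The two wedge products thus differ by the factor [\det X]. *)
have /submxP[X eX] : (rowsub phi M <= rowsub phi b)%MS.
  apply: rowsub_sub => i; rewrite raddfD /=; have [ie|ie] := boolP (phi i \in e).
    rewrite -(frame_mask _ _ _ _ _ _ fr) row_mask inE ie addr0.
    by rewrite -be row_mask ie; apply: (eq_row_sub i); rewrite row_rowsub.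
  rewrite -be row_mask (negPf ie) add0r.
  have : (row (phi i) N <= mask (F phi) *m N)%MS.
    by apply: (eq_row_sub (phi i)); rewrite row_mask inE imset_f ?orbT.
  rewrite -bCe => /submx_trans; apply; apply/row_subP=> j; rewrite row_mask inE.
  case: ifP => [ej|_]; last exact: sub0mx.
  have [fj|nfj] := boolP (j \in F phi).
    by apply: row_rowsub_sub; move: fj; rewrite inE (negPf ej).
  rewrite -(gram_mask_row _ _ bb) row_mask in_setD1 (negPf nfj) andbF.
  exact: sub0mx.
exists (k`!%:R^-1 * (a (rowsub phi D) * \det X),
        fun u => \det (u *m (rowsub phi b)^T)); split=> [u|/=].
  by rewrite eX trmx_mul mulmxA det_mulmx det_tr /=; ring.
right; split=> //; first by rewrite faces_fromE.
rewrite BLambda_facesE // sef /=.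
have := (leq_card_setU e [set phi i | i : 'I_k]).1; rewrite -/(F phi) card_im.
by move: ltkF; rewrite /sdim; move: #|F phi| #|e| => m n; lia.
Qed.

(** In dimension [k], a [k]-tuple of distinct basis vectors uses the whole basis, in particular
    every vector normal to [e]. *)
Lemma star_Alt_top (o : bool) e f c :
  e != finset.set0 -> e \subset f -> sdim f = k -> Alt k (tangent v f) c ->
  exists x : {ffun 'I_k -> 'I_d.+1} -> R * kform k,
  (forall u, c u = \sum_phi (x phi).1 * (x phi).2 u) /\
  forall phi, (x phi).1 = 0 \/ star_Alt v o k f e (x phi).2.
Proof.
case/set0Pn=> e0 ee0 sef df cAlt.
have [t [N [G fr]]] := frame_exists _ v_affine _ _ ee0.
have [b [bb bf be bCe]] := face_basis _ fr _ sef.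
exists (fun phi => (k`!%:R^-1 * c (rowsub phi b),
                    fun u => \det (u *m (rowsub phi b)^T))).
split=> [u|phi /=].
  rewrite (Alt_expand _ _ _ _ _ _ bb bf cAlt) mulr_sumr.
  by apply: eq_bigr => phi _; rewrite mulrA.
have [->|nz] := eqVneq (c (rowsub phi b)) 0; first by left; rewrite mulr0.
have [inj_phi phif] := Alt_coef _ _ _ _ _ _ _ bb bf cAlt nz.
right; apply: (star_Alt_det_form _ fr o _ _ _ sef _ bb bf be); first by rewrite df.
split=> //; suff -> : [set phi i | i : 'I_k] = f :\ e0.
  by apply: setDS; rewrite sub1set.
apply/eqP; rewrite eqEcard card_imset // card_ord; apply/andP; split.
  by apply/subsetP=> _ /imsetP[i _ ->].
by rewrite -df /sdim (cardsD1 e0 f) (subsetP sef).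
Qed.

End FaceDecomposition.

(** * The geometric decomposition *)

Lemma sum_single (V : nmodType) (I : finType) (P : {pred I}) (F : I -> V) i :
  P i -> (forall j, j != i -> F j = 0) -> \sum_(j | P j) F j = F i.
Proof. by move=> Pi F0; rewrite (bigD1 i) //= big1 ?addr0 // => j /andP[_ /F0]. Qed.

Section Assembly.
Context {R : realType} {d k r : nat}.
Variables (v : 'I_d.+1 -> 'rV[R]_d) (lam : 'I_d.+1 -> {mpoly R[d]}).
Variable o : {set 'I_d.+1} -> bool.
Hypothesis r_gt0 : (1 <= r)%N.
Hypotheses (v_affine : affinely_independent v) (lamP : barycentric v lam).
Implicit Types e f : {set 'I_d.+1}.

Local Notation form := ('M[R]_(k, d) -> {mpoly R[d]}).
Local Notation summand := (BLambda_summand v lam o r k).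

Lemma face_neq0 f : f \in faces_from k -> f != finset.set0.
Proof. by rewrite faces_fromE -card_gt0; apply: leq_ltn_trans. Qed.

Lemma subface_neq0 f e :
  f \in faces_from k -> e \in BLambda_faces k f -> e != finset.set0.
Proof.
move/face_neq0/BLambda_facesE => -> /andP[_]; rewrite -card_gt0.
exact: leq_ltn_trans.
Qed.

Lemma sdimS f : f != finset.set0 -> (sdim f).+1 = #|f|.
Proof. by rewrite -card_gt0 /sdim => /prednK. Qed.

Lemma face_sdim f : f \in faces_from k -> (k <= sdim f)%N.
Proof. by move=> fF; rewrite -ltnS (sdimS _ (face_neq0 _ fF)) -faces_fromE. Qed.

Lemma summand_subspace f e : linear_subspace (summand f e : form -> Prop).
Proof. exact: lin_span_subspace. Qed.

Lemma BLambda_subspace f : linear_subspace (BLambda v lam o r k f : form -> Prop).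
Proof. by apply: sum_space_subspace => e; apply: summand_subspace. Qed.

Lemma summand_tensor f e c q : e != finset.set0 -> star_Alt v (o f) k f e c ->
  Bernstein lam (r%:Z - #|e|%:Z) e q ->
  summand f e (fun u => c u *: (bubble lam e * q)).
Proof.
move=> e0 cS Bq; apply: sub_lin_span; exists (bubble lam e * q), c; split=> //.
by exists q => //; rewrite sdimS.
Qed.

Lemma summand_ind f e (T : form -> Prop) : e != finset.set0 -> linear_subspace T ->
  (forall c q, star_Alt v (o f) k f e c -> Bernstein lam (r%:Z - #|e|%:Z) e q ->
     T (fun u => c u *: (bubble lam e * q))) ->
  forall w, summand f e w -> T w.
Proof.
move=> e0 sT gT; apply: lin_span_min => // _ [_ [c [[q Bq <-] cS ->]]].
by apply: gT => //; rewrite -sdimS.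
Qed.

(* The coefficients of w are separated first, by the supports of the Bernstein
   monomials; evaluation on the tuples drawn from a basis adapted to e then
   separates the faces f containing e. *)
Lemma joint_direct (w : {set 'I_d.+1} -> {set 'I_d.+1} -> form) :
  (forall f e, f \in faces_from k -> e \in BLambda_faces k f -> summand f e (w f e)) ->
  \sum_(f in faces_from k) \sum_(e in BLambda_faces k f) w f e = 0 ->
  forall f e, f \in faces_from k -> e \in BLambda_faces k f -> w f e = 0.
Proof.
move=> wS w0.
(* Extension by zero lets both sums run over all vertex sets, so that they can be exchanged. *)
pose w' f e : form := if (f \in faces_from k) && (e \in BLambda_faces k f) then w f e else 0.
have w'0 u e : \sum_f w' f e u = 0.
  apply: (bubble_Bernstein_direct _ _ lamP r (fun e => \sum_f w' f e u)); last first.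
    rewrite exchange_big /=; have := congr1 (fun g : form => g u) w0.
    rewrite fct_sumE big_mkcond => h; rewrite -[RHS]h; apply: eq_bigr => f _.
    rewrite /w'; case: ifP => fF /=; last by rewrite big1.
    by rewrite fct_sumE [RHS]big_mkcond; apply: eq_bigr => e' _; case: ifP.
  move=> {}e.
  pose T p := exists2 q, Bernstein lam (r%:Z - #|e|%:Z) e q & p = bubble lam e * q.
  have sT : linear_subspace T.
    have [B0 BD] := Bernstein_subspace lam (r%:Z - #|e|%:Z) e.
    split=> [|c _ _ [q Bq ->] [q' Bq' ->]]; first by exists 0; rewrite ?mulr0.
    by exists (c *: q + q'); [apply: BD | rewrite mulrDr scalerAr].
  apply: (subspace_sum T _ _ _ _ sT) => f _; rewrite /w'.
  case: ifP => [/andP[fF eF]|_]; last by case: sT.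
  have e0 := subface_neq0 _ _ fF eF.
  move: (wS _ _ fF eF); apply: (summand_ind _ _ (fun g => T (g u)) e0).
    split=> [|c x y Tx Ty]; first by case: sT.
    by case: sT => _ TD; apply: TD.
  by move=> c q _ Bq; apply: subspaceZ => //; exists q.
move=> f e fF eF; have e0 := subface_neq0 _ _ fF eF.
have [D [M DM]] := star_Alt_dual_basis _ v_affine (k := k) _ e0.
pose Expands (g : form) := forall u, g u = k`!%:R^-1 *:
  \sum_(psi : {ffun 'I_k -> 'I_d.+1}) \det (u *m (rowsub psi M)^T) *: g (rowsub psi D).
pose Vanishes f' (g : form) := forall psi : {ffun 'I_k -> 'I_d.+1},
  [set psi i | i : 'I_k] :\: e != f' :\: e -> g (rowsub psi D) = 0.
have wP f' : f' \in faces_from k -> e \in BLambda_faces k f' ->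
    Expands (w f' e) /\ Vanishes f' (w f' e).
  move=> f'F ef'; have f'0 := face_neq0 _ f'F.
  have /andP[sef' _] : (e \subset f') && (sdim f' - k < #|e|)%N.
    by rewrite -BLambda_facesE.
  move: (wS _ _ f'F ef').
  apply: (summand_ind _ _ (fun g => Expands g /\ Vanishes f' g) e0).
    split=> [|c x y [Ex Vx] [Ey Vy]].
      split=> [u|psi _] //; rewrite big1 ?scaler0 // => psi _.
      exact: scaler0.
    split=> [u|psi ne]; last first.
      by rewrite addrfctE scalrfctE Vx // Vy // scaler0 addr0.
    rewrite addrfctE scalrfctE /= Ex Ey scalerA mulrC -scalerA -scalerDr.
    congr (_ *: _); rewrite scaler_sumr -big_split; apply: eq_bigr => psi _ /=.
    by rewrite scalerDr !scalerA mulrC.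
  move=> c q cS _; have [cE cV] := DM _ _ _ sef' (face_sdim _ f'F) cS.
  split=> [u|psi ne].
    rewrite cE -scalerA scaler_suml; congr (_ *: _); apply: eq_bigr => psi _.
    by rewrite mulrC -scalerA.
  have [->|/cV e1] := eqVneq (c (rowsub psi D)) 0; first by rewrite scale0r.
  by rewrite e1 eqxx in ne.
have [wE wV] := wP _ fF eF.
apply: funext => u; rewrite wE big1 ?scaler0 // => psi _.
suff -> : w f e (rowsub psi D) = 0 by rewrite scaler0.
have [imf|/wV //] := eqVneq ([set psi i | i : 'I_k] :\: e) (f :\: e).
(* On this tuple only [f] can contribute to the sum, since a face containing [e] is determined by
   its vertices outside [e]. *)
have := w'0 (rowsub psi D) e; rewrite (bigD1 f) //= big1 => [|f' ne].
  by rewrite /w' fF eF addr0.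
rewrite /w'; case: ifP => [/andP[f'F ef']|//].
have [_ wV'] := wP _ f'F ef'; apply: wV'; apply: contraNneq ne => imf'.
have sub g : g \in faces_from k -> e \in BLambda_faces k g -> e :|: (g :\: e) = g.
  move=> gF; rewrite (BLambda_facesE _ _ _ (face_neq0 _ gF)) => /andP[sg _].
  by rewrite -{1}(setIidPr sg) setID.
by rewrite -(sub _ fF eF) -(sub _ f'F ef') -imf -imf'.
Qed.

Lemma PLambda_subspace : linear_subspace (@PLambda R d r k : form -> Prop).
Proof. exact: lin_span_subspace. Qed.

Lemma Alt_fullP (a : @kform R d k) : Alt k 1%:M a <-> alternating_on 1%:M a.
Proof.
have I1 : (1%:M : 'M[R]_d) *m 1%:M^T = mask [set: 'I_d] by rewrite trmx1 mulmx1 maskT.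
split=> [/(AltP _ _ _ _ _ I1 (eqmx_refl _))[]//|aa].
by apply/(AltP _ _ _ _ _ I1 (eqmx_refl _)); split=> // u; rewrite trmx1 !mulmx1.
Qed.

Lemma BLambda_sub_PLambda f : f \in faces_from k ->
  forall w, BLambda v lam o r k f w -> @PLambda R d r k w.
Proof.
move=> fF _ [w wS ->]; apply: (subspace_sum _ _ _ _ _ PLambda_subspace) => e eF.
have e0 := subface_neq0 _ _ fF eF.
move: (wS _ eF); apply: (summand_ind _ _ _ e0 PLambda_subspace) => c q cS Bq.
apply: sub_lin_span; exists (bubble lam e * q), c; split=> //.
  exact: bubble_Bernstein_deg lamP _ _ _ Bq.
case: cS => a _ [cA _]; apply/Alt_fullP.
have [e1 ee1] := set0Pn _ e0; have [t [N [G fr]]] := frame_exists _ v_affine _ _ ee1.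
have sef : e \subset f.
  by move: eF; rewrite (BLambda_facesE _ _ _ (face_neq0 _ fF)) => /andP[].
have [b [bb bf _ _]] := face_basis _ fr _ sef.
by have [] := (AltP _ _ _ _ _ bb bf).1 cA.
Qed.

(** The polynomial is expanded in Bernstein monomials, and for each of them the form is decomposed
    relative to the face [e] supporting it. *)
Lemma PLambda_sub_sum (w : form) : @PLambda R d r k w ->
  sum_space (faces_from k) (BLambda v lam o r k) w.
Proof.
set T := sum_space _ _.
have sT : linear_subspace T.
  by apply: sum_space_subspace => f; apply: BLambda_subspace.
apply: (lin_span_min _ T sT) => _ [p [a [pr /Alt_fullP aa ->]]].
have aT : linear_subspace (fun p => T (fun u => a u *: p)).
  case: sT => T0 TD; split=> [|c x y Tx Ty].
    by have -> : (fun u => a u *: (0 : {mpoly R[d]})) = 0 by apply: funext => u; rewrite scaler0.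
  suff -> : (fun u => a u *: (c *: x + y))
      = c *: (fun u => a u *: x) + (fun u => a u *: y) :> form by apply: TD.
  by apply: funext => u; rewrite addrfctE scalrfctE /= scalerDr !scalerA mulrC.
move: p {pr}(Bernstein_full _ _ v_affine lamP _ _ pr).
apply: (lin_span_min _ (fun p => T (fun u => a u *: p)) aT) => _ [alpha ea ->].
have [q Bq ->] := monomial_support lam _ _ _ ea.
move: Bq; set e := [set _ in _ | _] => Bq.
(* The exponents have the positive sum [r], so the support is not empty. *)
have e0 : e != finset.set0.
  apply: contraTneq r_gt0 => e0; case: ea => <-; rewrite big1 // => i _.
  apply/eqP; apply: contraTT isT => ai.
  by have : i \in e; [rewrite !inE ai | rewrite e0 inE].
have [F [x [ax xP]]] := alternating_star_sum _ v_affine o _ _ e0 aa.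
have -> : (fun u => a u *: (bubble lam e * q))
    = \sum_phi (x phi).1 *: (fun u => (x phi).2 u *: (bubble lam e * q)) :> form.
  apply: funext => u; rewrite fct_sumE ax scaler_suml; apply: eq_bigr => phi _.
  by rewrite scalrfctE scalerA.
apply: subspace_sum => // phi _; case: (xP phi) => [->|[FF eF cS]].
  by rewrite scale0r; case: sT.
apply: subspaceZ => //; apply: (sub_sum_space _ _ _ _ BLambda_subspace FF).
by apply: (sub_sum_space _ _ _ _ (summand_subspace _) eF); apply: summand_tensor.
Qed.

Lemma PLambda_face_BLambda f : f \in faces_from k -> sdim f = k ->
  PLambda_face v lam r k f = BLambda v lam o r k f.
Proof.
move=> fF df; have f0 := face_neq0 _ fF; apply/seteqP; split=> w; last first.
  case=> {}w wS ->.
  have sP : linear_subspace (PLambda_face v lam r k f : form -> Prop).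
    exact: lin_span_subspace.
  apply: (subspace_sum _ _ _ _ _ sP) => e eF.
  have e0 := subface_neq0 _ _ fF eF.
  move: (wS _ eF); apply: (summand_ind _ _ _ e0 sP) => c q [a _ [cA _]] Bq.
  apply: sub_lin_span; exists (bubble lam e * q), c; split=> //.
  apply: bubble_Bernstein_sub Bq.
  by move: eF; rewrite BLambda_facesE // => /andP[].
have [B0 BD] := BLambda_subspace f.
apply: (lin_span_min _ (BLambda v lam o r k f)) => // _ [p [c [Bp cA ->]]].
move: p Bp.
apply: (lin_span_min _ (fun p => BLambda v lam o r k f (fun u => c u *: p))).
  split=> [|x p q Tp Tq].
    by have -> : (fun u => c u *: (0 : {mpoly R[d]})) = 0 by apply: funext => u; rewrite scaler0.
  suff -> : (fun u => c u *: (x *: p + q))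
      = x *: (fun u => c u *: p) + (fun u => c u *: q) :> form by apply: BD.
  by apply: funext => u; rewrite addrfctE scalrfctE /= scalerDr !scalerA mulrC.
move=> _ [alpha ea ->]; have [q Bq ->] := monomial_support lam _ _ _ ea.
move: Bq; set e := [set _ in _ | _] => Bq.
have e0 : e != finset.set0.
  apply: contraTneq r_gt0 => e0; case: ea => <-; rewrite big1 // => i fi.
  apply/eqP; apply: contraTT isT => ai.
  by have : i \in e; [rewrite !inE fi ai | rewrite e0 inE].
have sef : e \subset f by apply/subsetP=> i; rewrite inE => /andP[].
have [x [cx xP]] := star_Alt_top _ v_affine (o f) _ _ _ e0 sef df cA.
have -> : (fun u => c u *: (bubble lam e * q))
    = \sum_phi (x phi).1 *: (fun u => (x phi).2 u *: (bubble lam e * q)) :> form.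
  apply: funext => u; rewrite fct_sumE cx scaler_suml; apply: eq_bigr => phi _.
  by rewrite scalrfctE scalerA.
apply: subspace_sum => // phi _; case: (xP phi) => [->|cS].
  by rewrite scale0r.
apply: subspaceZ => //; apply: (sub_sum_space _ _ e _ (summand_subspace _)).
  (* As [sdim f - k] is 0, every nonempty subset of [f] indexes a summand. *)
  by rewrite BLambda_facesE // sef df subnn card_gt0.
exact: summand_tensor.
Qed.

(** Joint independence is applied to the family that is zero at every face other than [f]. *)
Lemma summands_direct f : f \in faces_from k ->
  direct_family (BLambda_faces k f) (summand f : _ -> form -> Prop).
Proof.
move=> fF w wS w0 e eF.
pose W f' e' : form := if f' == f then w e' else 0.
suff : W f e = 0 by rewrite /W eqxx.
apply: (joint_direct W _ _ _ _ fF eF) => [f' e' f'F e'F|].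
  rewrite /W; case: eqP => [ef|_]; last by case: (summand_subspace f' e').
  by move: e'F; rewrite ef => /wS.
have -> := @sum_single _ _ _ (fun f' => \sum_(e in BLambda_faces k f') W f' e) f fF.
  by rewrite -[RHS]w0; apply: eq_bigr => e' _; rewrite /W eqxx.
by move=> f' /negPf ne; apply: big1 => e' _; rewrite /W ne.
Qed.

Lemma BLambda_direct_sum :
  is_direct_sum (faces_from k) (BLambda v lam o r k) (@PLambda R d r k).
Proof.
split.
  apply/seteqP; split=> w; first exact: PLambda_sub_sum.
  case=> {}w wB ->; apply: (subspace_sum _ _ _ _ _ PLambda_subspace) => f fF.
  exact: BLambda_sub_PLambda fF _ (wB _ fF).
move=> w wB w0.
(* Splitting each [w f] into its summands reduces directness to joint independence. *)
have chi f : exists wf : {set 'I_d.+1} -> form, f \in faces_from k ->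
    (forall e, e \in BLambda_faces k f -> summand f e (wf e)) /\
    w f = \sum_(e in BLambda_faces k f) wf e.
  have [/wB[wf wfS wfE]|nF] := boolP (f \in faces_from k); first by exists wf.
  by exists (fun=> 0).
have [W WP] := choice chi.
have W0 := joint_direct W (fun f e fF => (WP f fF).1 e).
move=> f fF; rewrite (WP f fF).2 big1 // => e eF; apply: W0 => //.
by rewrite -[RHS]w0; apply: eq_bigr => f' f'F; rewrite (WP f' f'F).2.
Qed.

End Assembly.

Theorem theorem5p7 (R : realType) (d k r : nat)
    (v : 'I_d.+1 -> 'rV[R]_d) (lam : 'I_d.+1 -> {mpoly R[d]})
    (o : {set 'I_d.+1} -> bool) :
  (2 <= d)%N -> (k <= d)%N -> (1 <= r)%N ->
  affinely_independent v -> barycentric v lam ->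
  [/\ (* the sum defining each BLambda f is direct *)
      forall f, f \in faces_from k ->
        direct_family (BLambda_faces k f) (BLambda_summand v lam o r k f),
      is_direct_sum (faces_from k) (BLambda v lam o r k)
        (PLambda r k)
    & is_direct_sum (faces_from k)
        (fun f => if sdim f == k then PLambda_face v lam r k f
                  else BLambda v lam o r k f)
        (PLambda r k)].
Proof.
move=> _ _ r_gt0 v_affine lamP.
have [sumB dirB] := BLambda_direct_sum (k := k) v lam o r_gt0 v_affine lamP.
(* The two families consist of the same spaces face by face, so the second decomposition follows
   from the first. *)
have eqF f : f \in faces_from k -> BLambda v lam o r k f =
    if sdim f == k then PLambda_face v lam r k f else BLambda v lam o r k f.
  by move=> fF; case: eqP => // df; rewrite (PLambda_face_BLambda _ _ o).
split=> [f fF||]; [exact: (summands_direct _ _ _ v_affine lamP) | by [] |].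
split; first by rewrite sumB; apply: eq_sum_space.
exact: eq_direct_family eqF dirB.
Qed.
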